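(* Let $A,B\subset\mathbb{R}^n_+$ be anti-blocking bodies. Then, for any proper coordinate subspace $E$ of $\mathbb{R}^n$ of dimension $i$, $$\frac{|A|}{|P_EA|}+\frac{|B|}{|P_EB|}\le r_{n,i}\,\frac{|A-B|}{|P_E(A-B)|},$$ where $$r_{n,i}:=\max_{0\le j\le n} d_{n,2}(i,j),\qquad d_{n,2}(i,j):=\frac{\binom{i}{N}\binom{j}{N}}{\binom{n}{N}},\quad N=i+j-n\ge 0.$$ Moreover, the constant $r_{n,i}$ is the best possible constant.
   Context: $\mathbb{R}^n_+=[0,\infty)^n$. A convex body is a convex, compact, non-empty set. A coordinate subspace is one spanned by a subset of the standard orthonormal basis $e_1,\dots,e_n$ of $\mathbb{R}^n$. $P_E$ denotes the orthogonal projection onto $E$. A convex body $K\subset\mathbb{R}^n_+$ is anti-blocking if $P_EK=K\cap E$ for every coordinate subspace $E$. $A-B=\{a-b:a\in A,\ b\in B\}$. For a measurable set $K$, $|K|$ denotes the $m$-dimensional Lebesgue measure (volume) of $K$, where $m$ is the dimension of the minimal affine space containing $K$; it is agreed that $|P_EK|=1$ when $E=\{0\}$. The maximum defining $r_{n,i}$ is over integers $j$ with $0\le j\le n$ for which $N=i+j-n\ge 0$.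
   Formalization: Volumes are n-dimensional for A, B, A−B and i-dimensional for projections onto E, not taken in the affine hull (0/0 read as 0): with affine-hull volumes the claim fails for A={0}, B=[0,1], E={0} in R^1. The two agree for bodies with nonempty interior. *)

(* Defs.v *)
From HB Require Import structures.
From mathcomp Require Import all_boot all_order all_algebra.
From mathcomp Require Import all_classical all_reals all_analysis.
Set Implicit Arguments.
Unset Strict Implicit.
Unset Printing Implicit Defensive.
Import Order.TTheory GRing.Theory Num.Theory.
Import numFieldNormedType.Exports.
Local Open Scope classical_set_scope.
Local Open Scope ring_scope.

Lemma product_measure1_sigma_finite d1 d2 (T1 : measurableType d1)
    (T2 : measurableType d2) (R : realType)
    (m1 : {sigma_finite_measure set T1 -> \bar R})
    (m2 : {sigma_finite_measure set T2 -> \bar R}) :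
  sigma_finite setT (m1 \x m2)%E.
Proof.
have /sigma_finiteP[F [TF ndF Foo]] := sigma_finiteT m1.
have /sigma_finiteP[G [TG ndG Goo]] := sigma_finiteT m2.
exists (fun n => F n `*` G n).
  rewrite -setXTT TF TG predeqE => -[x y]; split.
    move=> [/= [n _ Fnx] [k _ Gky]]; exists (maxn n k) => //; split.
    - by move: x Fnx; exact/subsetPset/ndF/leq_maxl.
    - by move: y Gky; exact/subsetPset/ndG/leq_maxr.
  by move=> [n _ []/= ? ?]; split; exists n.
move=> k; have [? ?] := Foo k; have [? ?] := Goo k.
split; first exact: measurableX.
by rewrite product_measure1E// lte_mul_pinfty// ge0_fin_numE.
Qed.

Lemma sigma_finite_measureP d (T : measurableType d) (R : realType)
    (m : {measure set T -> \bar R}) : sigma_finite setT m ->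
  exists mu : {sigma_finite_measure set T -> \bar R}, m = mu :> (_ -> _).
Proof.
move=> sf.
pose H1 := isSFinite.Build _ _ _ _ (sfinite_measure_sigma_finite sf).
pose H2 := isSigmaFinite.Build _ _ _ _ sf.
pose mu := HB.pack_for (sigma_finite_measure T R) (Measure.sort m) H1 H2.
by exists mu.
Qed.

Section lebesgue_tuple.
Context {R : realType}.

Local Notation RT n := (n.-tuple (measurableTypeR R)).

Definition tcons n (p : measurableTypeR R * RT n) : RT n.+1 :=
  [the n.+1.-tuple (measurableTypeR R) of p.1 :: p.2].

(* n-dimensional Lebesgue measure, as an n-fold product measure; the empty
   product is the unit mass on the single point of R^0, so that a point has
   0-dimensional volume 1. *)
Fixpoint leb n : set (RT n) -> \bar R :=
  match n with
  | 0 => \d_([tuple] : RT 0)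
  | m.+1 => pushforward ((@lebesgue_measure R) \x (@leb m))%E (@tcons m)
  end.

Lemma measurable_tcons n : measurable_fun [set: _] (@tcons n).
Proof. by apply: measurable_cons; [exact: measurable_fst|exact: measurable_snd]. Qed.

Lemma leb_is_measure n : exists mu : {sigma_finite_measure set (RT n) -> \bar R},
  @leb n = mu :> (_ -> _).
Proof.
elim: n => [|n [mu IH]] /=; first by exists (\d_([tuple] : RT 0)).
rewrite IH.
pose m := ((@lebesgue_measure R) \x mu)%E.
pose f : {mfun _ >-> _} := mfun_Sub (mem_set (@measurable_tcons n)).
have mf : measurable_fun setT f by exact: measurable_funPT.
pose g (t : RT n.+1) : measurableTypeR R * RT n := (thead t, [tuple of behead t]).
have mg : measurable_fun setT g.
  apply/measurable_fun_pairP; split; first exact: measurable_tnth.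
  exact: measurable_behead.
have sf : sigma_finite setT (pushforward m f).
  have [F FT Ff] := product_measure1_sigma_finite (@lebesgue_measure R) mu.
  exists (fun i => g @^-1` F i); first by rewrite -preimage_bigcup -FT preimage_setT.
  move=> i; have [mF Fi] := Ff i; split.
    by rewrite -[X in measurable X]setTI; exact: mg.
  rewrite /pushforward -comp_preimage.
  suff -> : g \o f = id by [].
  by apply/funext => -[x t]; congr pair; apply: val_inj.
exact: (sigma_finite_measureP
  (m := measure_function_pushforward__canonical__measure_function_Measure m mf)).
Qed.

Lemma leb_box n (A : 'I_n -> set R) :
  (forall k, measurable (A k : set (measurableTypeR R))) ->
  @leb n [set t | forall k, A k (tnth t k)] =
  (\prod_(k < n) lebesgue_measure (A k : set (measurableTypeR R)))%E.
Proof.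
elim: n A => [|n IH] A mA /=.
  by rewrite big_ord0 diracE mem_set// => -[].
have [mu Hmu] := leb_is_measure n.
rewrite big_ord_recl -IH// /pushforward Hmu -product_measure1E //.
- congr product_measure1; apply/seteqP; split => -[x t] /=.
    move=> H; split; first exact: (H ord0).
    by move=> k; have := H (lift ord0 k); rewrite tnthS.
  move=> [Hx Ht] k; case: (unliftP ord0 k) => [j|] -> //.
  by rewrite tnthS; exact: Ht.
- rewrite (_ : [set t | _] = \bigcap_(k in [set: 'I_n])
    ((fun t : RT n => tnth t k) @^-1` A (lift ord0 k))).
    apply: fin_bigcap_measurable => // k _; rewrite -[X in measurable X]setTI.
    exact: measurable_tnth.
  by apply/seteqP; split => t /= H k; [move=> _|]; exact: H.
Qed.

End lebesgue_tuple.

Section anti_blocking.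
Context {R : realType} {n : nat}.
Implicit Types (A B K : set 'rV[R]_n) (I : {set 'I_n}) (x : 'rV[R]_n).

(* Coordinate subspaces are indexed by the set I of the basis vectors
   e_k = delta_mx 0 k that span them. *)
Definition coord_subspace I : set 'rV[R]_n :=
  [set x | exists a : 'I_n -> R, x = \sum_(k in I) a k *: delta_mx 0 k].

(* Orthogonal projection: x 0 k is the inner product of x with e_k. *)
Definition coord_proj I x : 'rV[R]_n := \sum_(k in I) x 0 k *: delta_mx 0 k.

Definition convex_body K :=
  [/\ convex_set K, compact K & K !=set0].

Definition nonneg_orthant : set 'rV[R]_n := [set x | forall k, 0 <= x 0 k].

Definition anti_blocking K :=
  [/\ convex_body K, K `<=` nonneg_orthant
    & forall I, coord_proj I @` K = K `&` coord_subspace I].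

Definition mdiff A B : set 'rV[R]_n := [set a - b | a in A & b in B].

(* #|I|-dimensional Lebesgue measure of a subset K of coord_subspace I, read in
   the orthonormal basis (e_k), k in I. The dimension is that of the subspace:
   it is the dimension of the affine hull of K exactly when K is
   full-dimensional in coord_subspace I; otherwise vol I K = 0 for convex K.
   (With the lower-dimensional volume of degenerate bodies instead, the
   inequality fails for A = {0}, B = [0, 1] in R^1 and the subspace {0}.) *)
Definition vol I K : R :=
  fine (leb [set t : #|I|.-tuple (measurableTypeR R) |
    K (\sum_(k < #|I|) tnth t k *: delta_mx 0 (enum_val k))]).

End anti_blocking.

Definition dconst (R : realType) (n i j : nat) : R :=
  let N := (i + j - n)%N in ('C(i, N) * 'C(j, N))%N%:R / 'C(n, N)%:R.

(* The condition n <= i + j is N >= 0, and the set of such j <= n contains n;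
   all values dconst R n i j are nonnegative, so the default 0 plays no role. *)
Definition rconst (R : realType) (n i : nat) : R :=
  \big[Num.max/0]_(j < n.+1 | (n <= i + j)%N) dconst R n i j.

(* Main.v *)
(* Splitting R^n by sign patterns gives |A - B| = \sum_L |P_L A| |P_(~L) B|, and
   likewise for P_E (A - B). Hence the upper bound follows, term by term, from
   |K| |P_J K| <= d |P_I K| |P_(J + ~I) K| for J included in I; the two families
   of terms obtained from A and from B are disjoint because E is proper.

   For this inequality, slice K along R^J. With M = |P_J K| and N = dim J, let
   U(s), W(s) be the measures of the sets of y in R^(I \ J), z in R^(~I) whose
   fibre in R^J has volume at least s M. Since the fibre over (y, z) is included
   in those over y and over z, |K| <= M \int U W, whereas |P_I K| = M \int U and
   |P_(J + ~I) K| = M \int W. The Brunn-Minkowski inequality in R^J makes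
   U(s) / (1 - s^(1/N))^a, with a = dim (I \ J), nondecreasing, and W is
   nonincreasing, so two applications of Chebyshev's integral inequality reduce
   the claim to the integrals of (1 - s^(1/N))^m, which are read off the standard
   simplex.

   The constant is approached with A = {|x_J| + max(|x_Y|, |x_Z|) <= 1}, where
   |.| is the sum of the coordinates, Y = I \ J and Z = ~I, and with B a box that
   is long in the directions of Y and thin in the others. *)
Require Import Defs.
From HB Require Import structures.
From mathcomp Require Import all_boot all_order all_algebra.
From mathcomp Require Import all_classical all_reals all_analysis.
From mathcomp Require Import measurable_realfun ring lra zify.
Set Implicit Arguments.
Unset Strict Implicit.
Unset Printing Implicit Defensive.
Import Order.TTheory GRing.Theory Num.Theory.
Import numFieldNormedType.Exports.
Local Open Scope classical_set_scope.
Local Open Scope ring_scope.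

(** The volume estimates are proved for down-closed convex sets ([corner_body]). There projections
    are sections, and Brunn-Minkowski is needed only for sets whose one-dimensional case consists of
    intervals starting at 0. With o_m(s) = (1 - s^(1/N))^m and a, b the dimensions of Y = I \ J and
    Z = ~I, the two Chebyshev steps are (int o_a)(int U W) <= (int U)(int o_a W) and (int o_b)(int W
    o_a) <= (int W)(int o_b o_a). The first uses that U / o_a grows while W decreases, the second
    that W / o_b grows while o_a decreases. Since int o_m = 1 / C(m + N, N), the quotient of the
    three integrals is C(i, N) C(j, N) / C(n, N) with i = a + N, j = b + N, n = a + b + N: this is
    the origin of [dconst]. For the extremal A, U and W are proportional to o_a and o_b and the
    joint layer is a product, so no step loses anything. The box isolates one J: in the limit only L
    = J + ~I survives in |A - B|, and only L = J in |P_E (A - B)|. *)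

Local Notation RT R m := (m.-tuple (measurableTypeR R)).

(** * Lebesgue measure on tuples *)

Section lebesgue_product.
Context {R : realType}.

(** [leb] is only a set function; this bundles it as a sigma-finite measure, to which product
    measures and Tonelli apply. *)
Definition leb_sigma m : {sigma_finite_measure set (RT R m) -> \bar R} :=
  projT1 (cid (@leb_is_measure R m)).

Lemma leb_sigmaE m : leb_sigma m = @leb R m :> (_ -> _).
Proof. by rewrite /leb_sigma; case: cid. Qed.

Lemma leb_sigma_app m A : leb_sigma m A = leb A.
Proof. by rewrite leb_sigmaE. Qed.

Definition tbox m (A : 'I_m -> set R) : set (RT R m) :=
  [set t | forall k, A k (tnth t k)].

Lemma measurable_tbox m (A : 'I_m -> set R) :
  (forall k, measurable (A k : set (measurableTypeR R))) -> measurable (tbox A).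
Proof.
move=> mA; rewrite (_ : tbox A = \bigcap_(k in [set: 'I_m])
    ((fun t : RT R m => tnth t k) @^-1` A k)).
  apply: fin_bigcap_measurable => // k _; rewrite -[X in measurable X]setTI.
  exact: measurable_tnth.
by apply/seteqP; split => t /= H k; [move=> _|]; exact: H.
Qed.

(** Boxes are stable under intersection and generate the product sigma-algebra, and the cubes over
    []-j, j]] exhaust the space with finite measure. Changes of variables can thus be checked on
    boxes. *)
Lemma leb_unique m (mu : {measure set (RT R m) -> \bar R}) :
  (forall A : 'I_m -> set R,
     (forall k, measurable (A k : set (measurableTypeR R))) ->
     mu (tbox A) = (\prod_(k < m) lebesgue_measure (A k : set (measurableTypeR R)))%E) ->
  forall X, measurable X -> leb X = mu X.
Proof.
move=> muE X mX; rewrite -leb_sigma_app.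
pose G : set (set (RT R m)) := [set B | exists2 A : 'I_m -> set R,
  (forall k, measurable (A k : set (measurableTypeR R))) & B = tbox A].
have mG : G `<=` measurable by move=> _ [A mA ->]; exact: measurable_tbox.
apply: (@measure_unique _ _ _ G (fun j : nat => tbox (fun _ => `]-j%:R, j%:R]%classic))) => //.
- apply/seteqP; split; last first.
    apply: smallest_sub; last exact: mG.
    exact: sigma_algebra_measurable.
  apply: (@smallest_sub _ (@sigma_algebra _ setT)).
    exact: smallest_sigma_algebra.
  move=> B /=; rewrite -bigcup_seq => -[k _ [A mA <-]]; apply: sub_sigma_algebra.
  exists (fun j => if j == k then A else setT); first by move=> j; case: ifP.
  rewrite setTI; apply/seteqP; split => t /=.
    by move=> At j; case: eqP => // ->.
  by move=> /(_ k); rewrite eqxx.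
- move=> _ _ [A mA ->] [B mB ->]; exists (fun k => A k `&` B k).
    by move=> k; apply: measurableI.
  by apply/seteqP; split => t /=; [move=> [HA HB] k; split|
    move=> H; split => k; have [] := H k].
- by move=> j; exists (fun=> `]-j%:R, j%:R]%classic) => // k; exact: measurable_itv.
- apply/seteqP; split => // t _ /=.
  pose M := \sum_(k < m) `|tnth t k : R|.
  exists (Num.Def.truncn M).+1 => // k /=.
  have : `|tnth t k : R| < (Num.Def.truncn M).+1%:R.
    apply: le_lt_trans (truncnS_gt _).
    by rewrite /M (bigD1 k)//= lerDl sumr_ge0.
  by rewrite in_itv /= ltr_norml => /andP[-> /ltW].
- move=> _ [A mA ->]; by rewrite [LHS]leb_sigma_app leb_box// muE.
- move=> j; rewrite [ltLHS]leb_sigma_app leb_box//.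
  clear.
  elim: m => [|m IH]; first by rewrite big_ord0 ltry.
  rewrite big_ord_recl; apply: lte_mul_pinfty => //.
  by rewrite lebesgue_measure_itv/=; case: ifP => // _; rewrite ltry.
Qed.

End lebesgue_product.

(** * Coordinate subspaces and their orthogonal splittings *)

Section coordinate_embedding.
Context {R : realType} {n : nat}.
Implicit Types (I : {set 'I_n}) (X : set 'rV[R]_n).

(** The sum inside [vol], named so that sections of a body by coordinate subspaces become sets of
    tuples. *)
Definition emb I (t : RT R #|I|) : 'rV[R]_n :=
  \sum_(k < #|I|) tnth t k *: delta_mx 0 (enum_val k).

Lemma emb_enum_val I t (k : 'I_#|I|) : emb t 0 (enum_val k) = tnth t k.
Proof.
rewrite /emb summxE (bigD1 k)//= !mxE !eqxx mulr1 big1 ?addr0// => j jk.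
by rewrite !mxE eqxx/= (inj_eq enum_val_inj) eq_sym (negbTE jk) mulr0.
Qed.

Lemma emb_notin I (t : RT R #|I|) j : j \notin I -> emb t 0 j = 0.
Proof.
move=> jI; rewrite /emb summxE big1// => k _; rewrite !mxE eqxx/=.
by case: eqP => [jk|]; rewrite ?mulr0//; rewrite jk enum_valP in jI.
Qed.

Lemma measurable_emb I j :
  measurable_fun setT (fun t : RT R #|I| => emb t 0 j : measurableTypeR R).
Proof.
have [jI|jI] := boolP (j \in I); last first.
  by rewrite (_ : (fun t => _) = cst 0)//; apply/funext => t; rewrite emb_notin.
rewrite (_ : (fun t => _) = (fun t => tnth t (enum_rank_in jI j))).
  exact: measurable_tnth.
by apply/funext => t; rewrite -emb_enum_val enum_rankK_in.
Qed.

(** Measurability is read on the tuple of coordinates, the space on which [leb] is defined. *)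
Definition borel X := measurable [set t : RT R n | X (\row_k tnth t k)].

Lemma borel_preimage d (T : measurableType d) (f : T -> 'rV[R]_n) X :
  (forall k, measurable_fun setT (fun t => f t 0 k : measurableTypeR R)) ->
  borel X -> measurable [set t | X (f t)].
Proof.
move=> mf mX; pose g t : RT R n := [tuple f t 0 k | k < n].
have mg : measurable_fun setT g.
  apply/measurable_fun_tnthP => k; rewrite (_ : _ \o _ = fun t => f t 0 k)//.
  by apply/funext => t /=; rewrite tnth_mktuple.
have := mg measurableT _ mX; rewrite setTI; congr measurable.
apply/seteqP; split => t /=; rewrite (_ : \row_k _ = f t)//;
  by apply/rowP => k; rewrite mxE tnth_mktuple.
Qed.

(** The complement is open, hence the union of the countably many cubes [V p], with rational centre
    and radius 1/(m + 1), that it contains. *)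
Lemma closed_borel X : closed X -> borel X.
Proof.
move=> cX; rewrite /borel -[X in measurable X]setCK; apply: measurableC.
pose V (p : {ffun 'I_n -> rat} * nat) : set 'rV[R]_n :=
  [set x | forall k, `|ratr (p.1 k) - x 0 k| < p.2.+1%:R^-1].
rewrite (_ : ~` _ = \bigcup_(p in [set p | V p `<=` ~` X])
    [set t : RT R n | V p (\row_k tnth t k)]); last first.
  apply/seteqP; split => t /=; last first.
    by move=> [p pX Vp]; exact: pX.
  move=> nX.
  have := closed_openC cX; rewrite openE => /(_ _ nX).
  rewrite /interior -nbhs_ballE => -[e /= e0 eX].
  (* Half of [e], because the distance from the given point to another point of the cube is
     estimated through the rational centre. *)
  have [m em] : exists m, (m.+1%:R^-1 : R) < e / 2.
    exists (Num.Def.truncn (e / 2)^-1).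
    by rewrite invf_plt ?posrE ?divr_gt0// truncnS_gt.
  have Q k : exists q : rat, `|ratr q - (tnth t k : R)| < m.+1%:R^-1.
    have /rat_in_itvoo[q] : (tnth t k : R) - m.+1%:R^-1 < (tnth t k : R) + m.+1%:R^-1.
      by rewrite -subr_gt0 opprD opprK addrACA subrr add0r addr_gt0.
    rewrite in_itv/= => /andP[q1 q2]; exists q.
    by rewrite ltr_distl q1 q2.
  have [q qP] := choice Q.
  exists ([ffun k => q k], m); last by move=> k; rewrite /= ffunE mxE.
  move=> x Vx; apply: eX; split => // i k; rewrite (ord1 i) mxE.
  have := Vx k; rewrite /= ffunE => xk; have qk := qP k.
  rewrite /ball/= (le_lt_trans (ler_distD (ratr (q k)) _ _))//.
  by rewrite [e]splitr ltrD ?(lt_trans _ em)// distrC.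
rewrite bigcup_mkcond; apply: countable_bigcupT_measurable.
  exact: countableP.
move=> p; case: ifP => // _.
pose W k := [set x : R | `|ratr (p.1 k) - x| < p.2.+1%:R^-1].
rewrite (_ : mkset _ = tbox W); last first.
  by apply/seteqP; split => t Vt k /=; have := Vt k; rewrite mxE.
apply: measurable_tbox => k.
exact: (@measurable_ball R (ratr (p.1 k)) (p.2.+1%:R^-1)).
Qed.

Lemma borel_emb I X : borel X -> measurable [set t : RT R #|I| | X (emb t)].
Proof. by apply: borel_preimage => k; exact: measurable_emb. Qed.

Lemma borel_emb2 I1 I2 X : borel X ->
  measurable [set p : RT R #|I1| * RT R #|I2| | X (emb p.1 + emb p.2)].
Proof.
apply: borel_preimage => k.
rewrite (_ : (fun t => _) = (fun p : RT R #|I1| * RT R #|I2| => emb p.1 0 k + emb p.2 0 k)); last first.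
  by apply/funext => p; rewrite mxE.
apply: measurable_funD.
  by apply: (@measurableT_comp _ _ _ _ _ _ (fun t : RT R #|I1| => emb t 0 k : measurableTypeR R)) => //; exact: measurable_emb.
by apply: (@measurableT_comp _ _ _ _ _ _ (fun t : RT R #|I2| => emb t 0 k : measurableTypeR R)) => //; exact: measurable_emb.
Qed.

(** The preimage of a box under the merging map [f] is a product of two boxes, so the image of the
    product measure agrees with [leb] on boxes, hence on all measurable sets. *)
Lemma leb_split I I1 I2 X : [disjoint I1 & I2]%B -> (I1 :|: I2)%SET = I -> borel X ->
  leb [set t : RT R #|I| | X (emb t)] =
  (leb_sigma #|I1| \x leb_sigma #|I2|)%E
    [set p : RT R #|I1| * RT R #|I2| | X (emb p.1 + emb p.2)].
Proof.
move=> dI UI bX.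
pose f (p : RT R #|I1| * RT R #|I2|) : RT R #|I| :=
  [tuple (emb p.1 + emb p.2) 0 (enum_val k) | k < #|I|].
have mf : measurable_fun setT f.
  apply/measurable_fun_tnthP => k.
  rewrite (_ : _ \o _ = (fun p : RT R #|I1| * RT R #|I2| =>
    emb p.1 0 (enum_val k) + emb p.2 0 (enum_val k))); last first.
    by apply/funext => p /=; rewrite tnth_mktuple mxE.
  apply: measurable_funD.
    by apply: (@measurableT_comp _ _ _ _ _ _ (fun t : RT R #|I1| => emb t 0 (enum_val k) : measurableTypeR R)) => //; exact: measurable_emb.
  by apply: (@measurableT_comp _ _ _ _ _ _ (fun t : RT R #|I2| => emb t 0 (enum_val k) : measurableTypeR R)) => //; exact: measurable_emb.
have embf p : emb (f p) = emb p.1 + emb p.2.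
  apply/rowP => j; have [jI|jI] := boolP (j \in I).
    by rewrite -(enum_rankK_in jI jI) emb_enum_val tnth_mktuple.
  rewrite mxE !emb_notin ?addr0//; apply: contra jI => jI; rewrite -UI inE jI//.
  by rewrite orbT.
rewrite (@leb_unique _ _ (measure_function_pushforward__canonical__measure_function_Measure (leb_sigma #|I1| \x leb_sigma #|I2|)%E mf)).
- by rewrite /= /pushforward; congr product_measure1; apply/seteqP; split => p /=; rewrite embf.
- move=> A mA /=; rewrite /pushforward.
  (* The sides of the box re-indexed by coordinates in ['I_n], so that they can be distributed
     between I1 and I2; off I the condition is vacuous and the side is the whole line. *)
  pose A' j := [set x | forall k : 'I_#|I|, enum_val k = j -> A k x].
  have A'E k : A' (enum_val k) = A k.
    apply/seteqP; split => [x|x Ax k' /enum_val_inj ->//].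
    exact.
  have mA' j : j \in I -> measurable (A' j : set (measurableTypeR R)).
    by move=> jI; rewrite -(enum_rankK_in jI jI) A'E.
  have I1I j : j \in I1 -> j \in I by rewrite -UI inE => ->.
  have I2I j : j \in I2 -> j \in I by rewrite -UI inE => ->; rewrite orbT.
  have -> : f @^-1` tbox A = tbox (fun k : 'I_#|I1| => A' (enum_val k)) `*`
                             tbox (fun k : 'I_#|I2| => A' (enum_val k)).
    apply/seteqP; split => -[t1 t2] /=.
      move=> H; split => k /= i ik; have := H i.
        rewrite tnth_mktuple mxE/= ik emb_enum_val (@emb_notin I2) ?addr0//.
        by rewrite (disjointFr dI) ?enum_valP.
      rewrite tnth_mktuple mxE/= ik emb_enum_val (@emb_notin I1) ?add0r//.
      by rewrite (disjointFl dI) ?enum_valP.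
    move=> [H1 H2] k /=; rewrite tnth_mktuple mxE/=.
    have : enum_val k \in (I1 :|: I2)%SET by rewrite UI enum_valP.
    rewrite inE => /orP[kI|kI].
      rewrite (@emb_notin I2) ?addr0 ?(disjointFr dI)//.
      rewrite -A'E -(enum_rankK_in kI kI) emb_enum_val; exact: H1.
    rewrite (@emb_notin I1) ?add0r ?(disjointFl dI)//.
    rewrite -A'E -(enum_rankK_in kI kI) emb_enum_val; exact: H2.
  rewrite product_measure1E; last 2 first.
  - by apply: measurable_tbox => k; apply: mA'; apply: I1I; exact: enum_valP.
  - by apply: measurable_tbox => k; apply: mA'; apply: I2I; exact: enum_valP.
  rewrite [X in (X * _)%E]leb_sigma_app [X in (_ * X)%E]leb_sigma_app !leb_box;
    try by move=> k; apply: mA';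
      first [exact: (I1I _ (enum_valP k)) | exact: (I2I _ (enum_valP k))].
  rewrite -!(big_enum_val (fun j => lebesgue_measure (A' j : set (measurableTypeR R)))).
  under [RHS]eq_bigr do rewrite -A'E.
  rewrite -(big_enum_val (fun j => lebesgue_measure (A' j : set (measurableTypeR R)))).
  rewrite -bigU//; apply: eq_bigl => j; by rewrite !inE -UI inE.
- exact: borel_emb.
Qed.

End coordinate_embedding.

(** * Scaling, sections of product measures and the layer-cake formula *)

Section lebesgue_scaling.
Context {R : realType}.

(** Checked on half-open intervals; a negative factor exchanges the closed and the open end.
    Negative factors matter because B enters A - B reflected. *)
Lemma lebesgue_measure_scale (c : R) (A : set (measurableTypeR R)) : c != 0 ->
  measurable A -> lebesgue_measure A =
    (`|c|%:E * lebesgue_measure ([set x | A (c * x)%R] : set (measurableTypeR R)))%E.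
Proof.
move=> c0 mA; pose f (x : measurableTypeR R) : measurableTypeR R := c * x.
have mf : measurable_fun setT f by exact: measurable_funM.
pose nu : {measure set _ -> \bar R} := mscale (NngNum (normr_ge0 c)) (measure_function_pushforward__canonical__measure_function_Measure (@lebesgue_measure R) mf).
rewrite (@lebesgue_measure_unique _ nu)//.
move=> _ [[a b]] /= _ <-; rewrite /nu /mscale/= /pushforward lebesgue_measure_itv/=.
have [c_gt0|c_lt0|] := ltgtP 0 c; last by move=> cE; rewrite -cE eqxx in c0.
- rewrite (_ : f @^-1` _ = `]a / c, b / c]%classic); last first.
    by apply/seteqP; split => x /=; rewrite !in_itv/= /f ltr_pdivrMr// ler_pdivlMr// (mulrC c).
  rewrite lebesgue_measure_itv/= !lte_fin ltr_pM2r ?invr_gt0//.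
  case: ifP => ab; rewrite ?mule0// -!EFinB -EFinM gtr0_norm//.
  by rewrite -mulrBl mulrC divfK// gt_eqF.
- rewrite (_ : f @^-1` _ = `[b / c, a / c[%classic); last first.
    by apply/seteqP; split => x /=; rewrite !in_itv/= /f ltr_ndivlMr// ler_ndivrMr// (mulrC c) andbC.
  rewrite lebesgue_measure_itv/= !lte_fin ltr_nM2r ?invr_lt0//.
  case: ifP => ab; rewrite ?mule0// -!EFinB -EFinM ltr0_norm//.
  by rewrite -mulrBl mulrC mulrN divfK ?lt_eqF// opprB.
Qed.

Definition tscale m (c : R) (t : RT R m) : RT R m := [tuple c * (tnth t k : R) | k < m].

Lemma measurable_tscale m c : measurable_fun setT (@tscale m c).
Proof.
apply/measurable_fun_tnthP => k.
rewrite (_ : _ \o _ = (fun t : RT R m => c * (tnth t k : R))); last first.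
  by apply/funext => t /=; rewrite tnth_mktuple.
by apply: measurable_funM => //; exact: measurable_tnth.
Qed.

Lemma leb_scale m (c : R) (X : set (RT R m)) : c != 0 -> measurable X ->
  leb X = ((`|c| ^+ m)%R%:E * leb [set t | X (tscale c t)])%E.
Proof.
move=> c0 mX.
have mf := @measurable_tscale m c.
have cm0 : 0 <= `|c| ^+ m by rewrite exprn_ge0.
pose nu : {measure set _ -> \bar R} := mscale (NngNum cm0) (measure_function_pushforward__canonical__measure_function_Measure (leb_sigma m) mf).
rewrite (@leb_unique _ _ nu)//.
  by congr (_ * _)%E; exact: leb_sigma_app.
move=> A mA; transitivity ((`|c| ^+ m)%R%:E * leb (@tscale m c @^-1` tbox A))%E.
  by congr (_ * _)%E; exact: leb_sigma_app.
rewrite (_ : _ @^-1` _ = tbox (fun k => [set x | A k (c * x)])); last first.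
  by apply/seteqP; split => t /= H k; have /= := H k; rewrite tnth_mktuple.
have mcA k : measurable ([set x | A k (c * x)] : set (measurableTypeR R)).
  have mc : measurable_fun setT (fun x : measurableTypeR R => c * x : measurableTypeR R).
    exact: measurable_funM.
  by rewrite -[X in measurable X]setTI; exact: mc.
rewrite leb_box//; under [RHS]eq_bigr => k _ do rewrite (lebesgue_measure_scale c0)//.
rewrite big_split/=; congr (_ * _)%E.
by rewrite prodEFin prodr_const card_ord.
Qed.

End lebesgue_scaling.

Section product_sections.
Local Open Scope ereal_scope.
Context d1 d2 (T1 : measurableType d1) (T2 : measurableType d2) (R : realType).
Variable m1 : {sigma_finite_measure set T1 -> \bar R}.
Variable m2 : {sigma_finite_measure set T2 -> \bar R}.
Implicit Types A : set (T1 * T2).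

Lemma product_measure1_section A :
  (m1 \x m2) A = \int[m1]_x m2 [set y | A (x, y)].
Proof. by apply: eq_integral => x _ /=; rewrite xsectionE. Qed.

Lemma measurable_section1 A : measurable A ->
  measurable_fun setT (fun x => m2 [set y | A (x, y)]).
Proof.
move=> mA; rewrite (_ : (fun x => _) = m2 \o xsection A).
  exact: measurable_fun_xsection.
by apply/funext => x /=; rewrite xsectionE.
Qed.

Lemma measurable_section2 A : measurable A ->
  measurable_fun setT (fun y => m1 [set x | A (x, y)]).
Proof.
move=> mA; rewrite (_ : (fun x => _) = m1 \o ysection A).
  exact: measurable_fun_ysection.
by apply/funext => x /=; rewrite ysectionE.
Qed.

Lemma section_swap A : measurable A ->
  \int[m1]_x m2 [set y | A (x, y)] = \int[m2]_y m1 [set x | A (x, y)].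
Proof.
move=> mA; transitivity (\int[m1]_x (m2 \o xsection A) x).
  by apply: eq_integral => x _ /=; rewrite xsectionE.
rewrite -indic_fubini_tonelli_FE// indic_fubini_tonelli//.
rewrite indic_fubini_tonelli_GE//.
by apply: eq_integral => x _ /=; rewrite ysectionE.
Qed.

End product_sections.

Section layer_cake.
Local Open Scope ereal_scope.
Context d (T : measurableType d) (R : realType).
Variable mu : {sigma_finite_measure set T -> \bar R}.

Let halfline (f : T -> \bar R) := [set p : T * measurableTypeR R | p.2%:E <= f p.1].

Let measurable_halfline f : measurable_fun setT f -> measurable (halfline f).
Proof.
move=> mf; rewrite -[halfline f]setTI; apply: measurable_lee => //.
  by apply/measurable_EFinP; exact: measurable_snd.
exact: measurableT_comp.
Qed.

Lemma measurable_level f : measurable_fun setT f ->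
  measurable_fun setT (fun s : measurableTypeR R => mu [set x | s%:E <= f x]).
Proof. by move=> /measurable_halfline /(measurable_section2 mu). Qed.

(** Tonelli for the region [S] under the graph of f: its section over x has length f x. *)
Lemma layer_cake (f : T -> \bar R) : measurable_fun setT f ->
  (forall x, 0 <= f x) ->
  \int[mu]_x f x =
  \int[@lebesgue_measure R]_(s in `]0%R, +oo[) mu [set x | s%:E <= f x].
Proof.
move=> mf f0.
pose S := [set p : T * measurableTypeR R | (0 < p.2)%R] `&` halfline f.
have mS : measurable S.
  apply: measurableI; last exact: measurable_halfline.
  rewrite (_ : [set p | _] = setT `*` `]0%R, +oo[%classic).
    exact: measurableX.
  by apply/seteqP; split => -[x s] /=; rewrite in_itv/= andbT// => -[].
transitivity (\int[mu]_x (@lebesgue_measure R) [set s | S (x, s)]).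
  apply: eq_integral => x _; have := f0 x.
  case fE : (f x) => [r| |]//; rewrite ?lee_fin => r0.
  - rewrite (_ : mkset _ = `]0%R, r]%classic).
      rewrite lebesgue_measure_itv/= lte_fin; case: ifP; first by rewrite sube0.
      by move/negbT; rewrite -leNgt => r0'; congr EFin; apply/eqP; rewrite eq_le r0 r0'.
    by apply/seteqP; split => s; rewrite /S /halfline/= in_itv/= fE lee_fin;
      [move=> [-> ->]|move=> /andP[]].
  - rewrite (_ : mkset _ = `]0%R, +oo[%classic).
      by rewrite lebesgue_measure_itv/= ltry.
    by apply/seteqP; split => s; rewrite /S /halfline/= in_itv/= fE leey andbT//;
      move=> [].
rewrite section_swap// [RHS]integral_mkcond; apply: eq_integral => s _.
rewrite patchE; case: ifPn => [|/negP] s0.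
  congr (mu _); apply/seteqP; split => x; rewrite /S /halfline/=; first by case.
  by rewrite inE/= in_itv/= andbT in s0.
rewrite (_ : mkset _ = set0) ?measure0// -subset0 => x [/= s0' _]; apply: s0.
by rewrite inE/= in_itv/= s0'.
Qed.

End layer_cake.

(** * The Brunn-Minkowski inequality for down-closed sets *)

Section brunn_minkowski1.
Context {R : realType}.

(** P and Q have measure at most their suprema, and S contains [[0, x + y]] for x in P and y in Q: a
    point z of this interval is z + 0 if z <= x and x + (z - x) otherwise. *)
Lemma brunn_minkowski1 (P Q S : set (measurableTypeR R)) (M : R) :
  measurable P -> measurable Q -> measurable S -> P 0 -> Q 0 ->
  (forall x, P x -> 0 <= x <= M) -> (forall x, Q x -> 0 <= x <= M) ->
  (forall x y, P x -> 0 <= y <= x -> P y) ->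
  (forall x y, Q x -> 0 <= y <= x -> Q y) ->
  (forall x y, P x -> Q y -> S (x + y)) ->
  (lebesgue_measure P + lebesgue_measure Q <= lebesgue_measure S)%E.
Proof.
move=> mP mQ mS P0 Q0 PM QM Pd Qd PQS.
have lesup (A : set (measurableTypeR R)) : measurable A -> A 0 ->
    (forall x, A x -> 0 <= x <= M) -> has_sup (A : set R) /\
    (lebesgue_measure A <= (sup (A : set R))%:E)%E.
  move=> mA A0 AM; have hs : has_sup (A : set R).
    by split; [exists 0|exists M => x /AM /andP[]].
  have s0 : 0 <= sup (A : set R) by apply: ub_le_sup => //; case: hs.
  split=> //; apply: (@le_trans _ _ (@lebesgue_measure R `[0, sup (A : set R)]%classic)).
    apply: le_measure; rewrite ?inE//= => x Ax /=; rewrite in_itv/=.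
    have /andP[-> _] := AM _ Ax; apply: ub_le_sup => //; by case: hs.
  rewrite lebesgue_measure_itv/= lte_fin; case: ifP => _; first by rewrite sube0.
  by rewrite lee_fin.
have [hP lP] := lesup _ mP P0 PM; have [hQ lQ] := lesup _ mQ Q0 QM.
apply: (@le_trans _ _ (sup (P : set R) + sup (Q : set R))%:E).
  by rewrite EFinD leeD.
apply/lee_addgt0Pr => e e0; have e2 : 0 < e / 2 by rewrite divr_gt0.
have [x Px xP] := sup_adherent e2 hP; have [y Qy yQ] := sup_adherent e2 hQ.
apply: (@le_trans _ _ ((x + y)%:E + e%:E)%E).
  rewrite -EFinD lee_fin; lra.
rewrite leeD2r//; apply: (@le_trans _ _ (@lebesgue_measure R `[0, x + y]%classic)).
  rewrite lebesgue_measure_itv/= lte_fin; case: ifP => xy; first by rewrite sube0.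
  by rewrite lee_fin leNgt xy.
have /andP[x0 _] := PM _ Px; have /andP[y0 _] := QM _ Qy.
apply: le_measure; rewrite ?inE//= => z /=; rewrite in_itv/= => /andP[z0 zxy].
have [zx|xz] := leP z x.
  by rewrite -[z]addr0; apply: PQS => //; apply: Pd Px _; rewrite z0.
rewrite -(subrKC x z); apply: PQS => //; apply: Qd Qy _; lra.
Qed.

End brunn_minkowski1.

Section brunn_minkowski.
Context {R : realType}.

Definition down_closed m (M : R) (A : set (RT R m)) :=
  [/\ measurable A, forall t, A t -> forall k, 0 <= (tnth t k : R) <= M &
    forall t t', A t -> (forall k, 0 <= (tnth t' k : R) <= (tnth t k : R)) -> A t'].

Definition slice m (A : set (RT R m.+1)) (x : R) : set (RT R m) :=
  [set t | A (tcons (x : measurableTypeR R, t))].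

Definition tadd m (t t' : RT R m) : RT R m :=
  [tuple (tnth t k : R) + (tnth t' k : R) | k < m].

Lemma tnth_tcons0 m (p : measurableTypeR R * RT R m) : tnth (tcons p) ord0 = p.1.
Proof. by []. Qed.

Lemma tnth_tconsS m (p : measurableTypeR R * RT R m) k :
  tnth (tcons p) (lift ord0 k) = tnth p.2 k.
Proof. by rewrite tnthS. Qed.

Lemma tadd_tcons m x y (t t' : RT R m) :
  tadd (tcons (x : measurableTypeR R, t)) (tcons (y : measurableTypeR R, t')) =
  tcons (((x : R) + (y : R) : measurableTypeR R), tadd t t').
Proof.
apply: eq_from_tnth => k; rewrite tnth_mktuple.
case: (unliftP ord0 k) => [j|] ->; last by rewrite !tnth_tcons0.
by rewrite !tnth_tconsS tnth_mktuple.
Qed.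

Lemma measurable_tcons_preimage m (A : set (RT R m.+1)) : measurable A ->
  measurable [set p : measurableTypeR R * RT R m | A (tcons p)].
Proof.
by move=> mA; rewrite -[X in measurable X]setTI; exact: measurable_tcons.
Qed.

Lemma leb_slice m (A : set (RT R m.+1)) : measurable A ->
  leb A = (\int[@lebesgue_measure R]_x leb_sigma m (slice A x))%E.
Proof.
by move=> mA; rewrite /= /pushforward -leb_sigmaE product_measure1_section.
Qed.

Lemma measurable_leb_slice m (A : set (RT R m.+1)) : measurable A ->
  measurable_fun setT (fun x : measurableTypeR R => leb_sigma m (slice A x)).
Proof.
by move=> /measurable_tcons_preimage mA; exact: (measurable_section1 (leb_sigma m) mA).
Qed.

Lemma measurable_slice m (A : set (RT R m.+1)) x : measurable A -> measurable (slice A x).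
Proof.
move=> /measurable_tcons_preimage /(measurable_xsection x).
by rewrite xsectionE.
Qed.

Lemma slice_down_closed m M (A : set (RT R m.+1)) x :
  down_closed M A -> down_closed M (slice A x).
Proof.
move=> [mA bA dA]; split; first exact: measurable_slice.
  by move=> t At k; have := bA _ At (lift ord0 k); rewrite tnth_tconsS.
move=> t t' At tt'; apply: (dA _ _ At) => k.
case: (unliftP ord0 k) => [j|] ->; rewrite ?tnth_tconsS ?tnth_tcons0//=.
by have := bA _ At ord0; rewrite tnth_tcons0/= => /andP[-> _] /=.
Qed.

Lemma slice_subset m M (A : set (RT R m.+1)) x y : 0 <= x <= y ->
  down_closed M A -> slice A y `<=` slice A x.
Proof.
move=> xy [mA bA dA] t At; apply: (dA _ _ At) => k.
case: (unliftP ord0 k) => [j|] ->; rewrite ?tnth_tconsS ?tnth_tcons0//=.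
by have := bA _ At (lift ord0 j); rewrite tnth_tconsS lexx => /andP[-> _].
Qed.

Lemma slice_bound m M (A : set (RT R m.+1)) x t :
  down_closed M A -> slice A x t -> 0 <= x <= M.
Proof. by move=> [_ bA _] /bA /(_ ord0); rewrite tnth_tcons0. Qed.

Lemma down_closed_fin m M (A : set (RT R m)) : down_closed M A -> (leb A < +oo)%E.
Proof.
move=> [mA bA _].
apply: (@le_lt_trans _ _ (leb (tbox (fun _ : 'I_m => `[0, M]%classic)))).
  rewrite -!leb_sigma_app; apply: le_measure; rewrite ?inE//.
    by apply: measurable_tbox.
rewrite leb_box//; elim: m {A mA bA} => [|m IH]; first by rewrite big_ord0 ltry.
rewrite big_ord_recl; apply: lte_mul_pinfty => //.
by rewrite lebesgue_measure_itv/=; case: ifP => // _; rewrite ltry.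
Qed.

Lemma leb_dim0 m (A : set (RT R m)) : (m = 0)%N -> A !=set0 -> leb A = 1%E.
Proof.
by case: m A => // A _ [t At]; rewrite (tuple0 t) in At; rewrite /= diracE mem_set.
Qed.

Lemma nth_root m (s : R) : (0 < m)%N -> 0 <= s -> exists2 r : R, 0 <= r & r ^+ m = s.
Proof.
move=> m0 s0; exists (s `^ m%:R^-1); first exact: powR_ge0.
rewrite -powR_mulrn ?powR_ge0// -powRrM mulVf ?powRr1// pnatr_eq0.
by rewrite -lt0n.
Qed.

(** Convexity of the power function, with weights p and q that are not normalised to sum 1. The
    defect in the induction is p q (x^(m+1) - y^(m+1)) (x - y), a product of two differences of the
    same sign. *)
Lemma power_mean_perspective m (x y p q : R) : 0 <= x -> 0 <= y -> 0 <= p -> 0 <= q ->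
  (p * x + q * y) ^+ m.+1 <= (p + q) ^+ m * (p * x ^+ m.+1 + q * y ^+ m.+1).
Proof.
move=> x0 y0 p0 q0; elim: m => [|m IH]; first by rewrite !expr1 expr0 mul1r.
rewrite exprSr; apply: (@le_trans _ _ ((p + q) ^+ m * (p * x ^+ m.+1 + q * y ^+ m.+1) * (p * x + q * y))).
  by rewrite ler_wpM2r// addr_ge0// mulr_ge0.
rewrite [(p + q) ^+ m.+1]exprSr -!mulrA ler_wpM2l ?exprn_ge0 ?addr_ge0//.
rewrite -subr_ge0.
have -> : (p + q) * (p * x ^+ m.+2 + q * y ^+ m.+2) -
    (p * x ^+ m.+1 + q * y ^+ m.+1) * (p * x + q * y) =
    p * q * ((x ^+ m.+1 - y ^+ m.+1) * (x - y)).
  by rewrite [x ^+ m.+2]exprSr [y ^+ m.+2]exprSr; ring.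
apply: mulr_ge0; first exact: mulr_ge0.
have [xy|yx] := leP x y.
  by rewrite mulr_le0// subr_le0//; apply: lerXn2r.
by rewrite mulr_ge0// subr_ge0; [apply: lerXn2r => //; exact: ltW|exact: ltW].
Qed.

(* Dividing the slice volumes by their maxima p ^+ m and q ^+ m, attained at 0,
   makes the layers of A and B live over the same interval [0, 1], where the
   one-dimensional inequality applies layer by layer. *)
Lemma brunn_minkowski m (A B C : set (RT R m)) (M a b : R) :
  down_closed M A -> down_closed M B -> measurable C ->
  A !=set0 -> B !=set0 -> (forall t t', A t -> B t' -> C (tadd t t')) ->
  0 <= a -> 0 <= b -> ((a ^+ m)%:E <= leb A)%E -> ((b ^+ m)%:E <= leb B)%E ->
  (((a + b) ^+ m)%R%:E <= leb C)%E.
Proof.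
elim: m A B C a b => [|m IH] A B C a b dA dB mC A0 B0 ABC a0 b0 aA bB.
  have [t At] := A0; have [t' Bt'] := B0.
  rewrite expr0 /= diracE mem_set//; have := ABC _ _ At Bt'.
  by rewrite (tuple0 (tadd _ _)).
have [mA bA cA] := dA; have [mB bB' cB] := dB.
pose z : RT R m.+1 := [tuple (0 : R) | k < m.+1].
have Az : A z.
  have [t At] := A0; apply: (cA _ _ At) => k; rewrite tnth_mktuple lexx/=.
  by have /andP[] := bA _ At k.
have Bz : B z.
  have [t Bt] := B0; apply: (cB _ _ Bt) => k; rewrite tnth_mktuple lexx/=.
  by have /andP[] := bB' _ Bt k.
have tz t : tadd t z = t.
  by apply: eq_from_tnth => k; rewrite !tnth_mktuple addr0.
have zt t : tadd z t = t.
  by apply: eq_from_tnth => k; rewrite !tnth_mktuple add0r.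
(* If [a] is 0, then C contains B because A contains the origin [z]; likewise for [b]. From then on
   both volumes are positive. *)
have [a_eq0|a_gt0] := eqVneq a 0.
  rewrite a_eq0 add0r (le_trans bB)// -!leb_sigma_app.
  by apply: le_measure; rewrite ?inE// => t Bt; rewrite -[t]zt; exact: ABC.
have [b_eq0|b_gt0] := eqVneq b 0.
  rewrite b_eq0 addr0 (le_trans aA)// -!leb_sigma_app.
  by apply: le_measure; rewrite ?inE// => t At; rewrite -[t]tz; exact: ABC.
have {a_gt0}a_gt0 : 0 < a by rewrite lt_neqAle eq_sym a_gt0.
have {b_gt0}b_gt0 : 0 < b by rewrite lt_neqAle eq_sym b_gt0.
have slice0 (D : set (RT R m.+1)) : down_closed M D -> D z ->
  forall c, 0 < c -> ((c ^+ m.+1)%:E <= leb D)%E ->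
  exists2 r, 0 < r & leb (slice D 0) = (r ^+ m)%:E.
- move=> dD Dz c c0 cD; have [mD _ _] := dD.
  have fD : (leb (slice D 0) < +oo)%E by exact: (down_closed_fin (slice_down_closed 0 dD)).
  (* In dimension 0 the slice has measure 1 and does not determine the radius; 1 is chosen. *)
  have [m0|m_gt0] := posnP m.
    exists 1 => //; rewrite expr1n; apply: leb_dim0 => //.
    exists [tuple (0 : R) | k < m]; rewrite /slice/= (_ : tcons _ = z)//.
    apply: eq_from_tnth => k; rewrite tnth_mktuple.
    by case: (unliftP ord0 k) => [j|] ->; rewrite ?tnth_tconsS ?tnth_tcons0//= tnth_mktuple.
  (* All slices are included in the one at 0; were it null, D would be null, against c > 0. *)
  have p0 : (0 < leb (slice D 0))%E.
    rewrite lt_neqAle -{2}leb_sigma_app measure_ge0 andbT; apply/eqP => /esym D0.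
    have := cD; rewrite leb_slice// integral0_eq ?lee_fin ?leNgt ?exprn_gt0//.
    move=> x _; apply/eqP; rewrite eq_le measure_ge0 andbT.
    have [xM|xM] := boolP (0 <= x <= M).
      rewrite -[leRHS]D0 -leb_sigma_app; apply: le_measure; rewrite ?inE; try exact: measurable_slice.
      by case/andP: xM => x0 _; apply: (slice_subset _ dD); rewrite lexx.
    rewrite (_ : slice D x = set0) ?measure0// -subset0 => t /(slice_bound dD).
    by rewrite (negbTE xM).
  have [r r0 rE] := nth_root m_gt0 (fine_ge0 (ltW p0)).
  exists r; last by rewrite rE fineK// ge0_fin_numE// ltW.
  rewrite lt_neqAle r0 andbT; apply/eqP => /esym r_eq0.
  have : 0 < fine (leb (slice D 0)) by rewrite fine_gt0// p0.
  by rewrite -rE r_eq0 expr0n gtn_eqF// ltxx.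
have [p p0 pE] := slice0 A dA Az a a_gt0 aA.
have [q q0 qE] := slice0 B dB Bz b b_gt0 bB.
pose fn (D : set (RT R m.+1)) r x := (((r ^+ m)^-1)%:E * leb_sigma m (slice D x))%E.
have fn0 D r x : 0 < r -> (0 <= fn D r x)%E.
  by move=> r0; rewrite mule_ge0// lee_fin invr_ge0 exprn_ge0 ?ltW.
have mfn D r : measurable D -> measurable_fun setT (fun x : measurableTypeR R => fn D r x).
  by move=> mD; apply: measurable_funeM; exact: measurable_leb_slice.
have fnE D r s x : 0 < r -> (s%:E <= fn D r x)%E = ((r ^+ m * s)%:E <= leb (slice D x))%E.
  by move=> r0; rewrite /fn lee_pdivlMl ?exprn_gt0// leb_sigma_app EFinM.
have fn_neg D r s x : down_closed M D -> 0 < r -> 0 < s -> (s%:E <= fn D r x)%E -> slice D x !=set0.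
  move=> dD r0 s0; rewrite fnE// => sD; apply/set0P/eqP => D0.
  move: sD; rewrite D0 -leb_sigma_app measure0 lee_fin leNgt mulr_gt0 ?exprn_gt0//.
have fn_le D r s x : down_closed M D -> 0 < r -> 0 < s -> leb (slice D 0) = (r ^+ m)%:E ->
    (s%:E <= fn D r x)%E -> s <= 1.
  move=> dD r0 s0 DE sD; have [t Dt] := fn_neg _ _ _ _ dD r0 s0 sD.
  have /andP[x0 _] := slice_bound dD Dt.
  move: sD; rewrite fnE// => sD; have [mD _ _] := dD.
  have : ((r ^+ m * s)%:E <= (r ^+ m)%:E)%E.
    rewrite (le_trans sD)// -DE -!leb_sigma_app le_measure ?inE//; try exact: measurable_slice.
    by apply: (slice_subset _ dD); rewrite lexx.
  by rewrite lee_fin -ler_pdivlMl ?exprn_gt0// mulVf ?gt_eqF ?exprn_gt0.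
(* With r^m = s (and r = 1 when m = 0) the slices have volumes at least (r p)^m and (r q)^m, so the
   induction hypothesis gives at least s (p + q)^m. This is why the slices of C are normalised by
   the radius p + q. *)
have key s x y : 0 < s -> (s%:E <= fn A p x)%E -> (s%:E <= fn B q y)%E ->
    (s%:E <= fn C (p + q)%R (x + y)%R)%E.
  move=> s0 sA sB; have s1 := fn_le _ _ _ _ dA p0 s0 pE sA.
  have [r [r0 sr rA rB]] : exists r, [/\ 0 <= r, s <= r ^+ m,
      (((r * p) ^+ m)%:E <= leb (slice A x))%E & (((r * q) ^+ m)%:E <= leb (slice B y))%E].
    have [m0|m_gt0] := posnP m.
      exists 1; rewrite expr1n !mul1r; split => //.
        by rewrite (leb_dim0 m0) ?m0//; apply: fn_neg sA.
      by rewrite (leb_dim0 m0) ?m0//; apply: fn_neg sB.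
    have [r r0 rE] := nth_root m_gt0 (ltW s0).
    exists r; split => //; rewrite ?rE// exprMn rE mulrC -fnE//.
  rewrite fnE ?addr_gt0//.
  apply: (@le_trans _ _ (((r * p + r * q) ^+ m)%:E)).
    by rewrite lee_fin -mulrDr exprMn mulrC ler_wpM2r// exprn_ge0 ?addr_ge0 ?ltW.
  apply: IH rA rB; rewrite ?mulr_ge0 ?(ltW p0) ?(ltW q0)//.
  - exact: slice_down_closed.
  - exact: slice_down_closed.
  - exact: measurable_slice.
  - exact: fn_neg sA.
  - exact: fn_neg sB.
  - by move=> t t' At Bt'; rewrite /slice /= -tadd_tcons; exact: ABC.
have intfn D (r : R) : measurable D -> 0 < r ->
    (\int[@lebesgue_measure R]_x fn D r x = ((r ^+ m)^-1)%R%:E * leb D)%E.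
  move=> mD r0; rewrite leb_slice// ge0_integralZl_EFin ?invr_ge0 ?exprn_ge0 ?ltW//.
  exact: measurable_leb_slice.
have pq0 : 0 < p + q by rewrite addr_gt0.
have : (\int[@lebesgue_measure R]_x fn A p x + \int[@lebesgue_measure R]_x fn B q x <=
        \int[@lebesgue_measure R]_x fn C (p + q)%R x)%E.
  rewrite !layer_cake; try by move=> x; exact: fn0. all: try exact: mfn.
  have mlev (D : set (RT R m.+1)) (r : R) : measurable D ->
      measurable_fun (`]0%R, +oo[%classic : set (measurableTypeR R)) (fun s : measurableTypeR R =>
        @lebesgue_measure R [set x | s%:E <= fn D r x]%E).
    by move=> mD; apply: measurable_funTS; apply: measurable_level; exact: mfn.
  rewrite -ge0_integralD//=; last 2 first.
  - exact: mlev.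
  - exact: mlev.
  apply: ge0_le_integral => //=.
  - by move=> s _; rewrite adde_ge0.
  - by apply: emeasurable_funD; exact: mlev.
  - exact: mlev.
  move=> s; rewrite in_itv/= andbT => s0.
  have mset (D : set (RT R m.+1)) (r : R) : measurable D -> measurable ([set x | s%:E <= fn D r x]%E : set (measurableTypeR R)).
    move=> mD; rewrite -[X in measurable X]setTI.
    by apply: emeasurable_fun_c_infty => //; exact: mfn.
  have lev (D : set (RT R m.+1)) r : down_closed M D -> 0 < r -> forall x,
      (s%:E <= fn D r x)%E -> 0 <= x <= M.
    move=> dD r0 x /(fn_neg _ _ _ _ dD r0 s0)[t]; exact: slice_bound.
  have lev_dc (D : set (RT R m.+1)) r : down_closed M D -> 0 < r -> forall x y,
      (s%:E <= fn D r x)%E -> 0 <= y <= x -> (s%:E <= fn D r y)%E.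
    move=> dD r0 x y; rewrite !fnE// => /le_trans sx yx; apply: sx.
    have [mD _ _] := dD; rewrite -!leb_sigma_app le_measure ?inE//; try exact: measurable_slice.
    exact: (slice_subset yx dD).
  (* Above level 1 both level sets are empty. Up to level 1 both contain 0, which the
     one-dimensional inequality requires. *)
  have [s1|s1] := leP s 1; last first.
    have lev0 (D : set (RT R m.+1)) r : down_closed M D -> 0 < r ->
        leb (slice D 0) = (r ^+ m)%:E -> [set x | s%:E <= fn D r x]%E = set0.
      move=> dD r0 DE; rewrite -subset0 => x /(fn_le _ _ _ _ dD r0 s0 DE).
      by rewrite leNgt s1.
    by rewrite (lev0 A p dA p0 pE) (lev0 B q dB q0 qE) measure0 add0e.
  have lev1 (D : set (RT R m.+1)) (r : R) : 0 < r ->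
        leb (slice D 0) = (r ^+ m)%:E -> (s%:E <= fn D r 0%R)%E.
    by move=> r0 DE; rewrite fnE// DE lee_fin ler_piMr// exprn_ge0 ?ltW.
  apply: (@brunn_minkowski1 _ _ _ _ M); try exact: mset.
  - exact: lev1.
  - exact: lev1.
  - exact: lev.
  - exact: lev.
  - exact: lev_dc.
  - exact: lev_dc.
  - by move=> x y; exact: key.
rewrite !intfn// lee_pdivlMl ?exprn_gt0// => H; apply: le_trans H.
apply: (@le_trans _ _ (((p + q) ^+ m)%R%:E * (((p ^+ m)^-1)%R%:E * (a ^+ m.+1)%R%:E + ((q ^+ m)^-1)%R%:E * (b ^+ m.+1)%R%:E))%E).
  rewrite -!EFinM lee_fin.
  (* The weights p and q sum to the radius of C, and p (a / p)^(m+1) = a^(m+1) / p^m is the lower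
     bound for the integral of the normalised slices of A. *)
  have -> : a + b = p * (a / p) + q * (b / q) by field; rewrite !gt_eqF.
  apply: le_trans (power_mean_perspective _ _ _ _ _) _; rewrite ?divr_ge0 ?(ltW p0) ?(ltW q0)//.
  have pE' (c r : R) : 0 < r -> r * (c / r) ^+ m.+1 = (r ^+ m)^-1 * c ^+ m.+1.
    move=> r0; rewrite expr_div_n [r ^+ m.+1]exprS.
    have rm : r ^+ m != 0 by rewrite expf_neq0// gt_eqF.
    have rn : r != 0 by rewrite gt_eqF.
    by move: (r ^+ m) (c ^+ m.+1) rm => u v u0; field; rewrite rn u0.
  by rewrite !pE'.
apply: lee_wpmul2l; first by rewrite lee_fin exprn_ge0// ltW.
by apply: leeD; apply: lee_wpmul2l => //; rewrite lee_fin invr_ge0 exprn_ge0// ltW.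
Qed.

End brunn_minkowski.

(** * Volume of the standard simplex *)

Section simplex.
Context {R : realType}.

Definition simplex m (r : R) : set (RT R m) :=
  [set t | (forall k, 0 <= (tnth t k : R)) /\ \sum_(k < m) (tnth t k : R) <= r].

Arguments simplex m r : clear implicits.

Lemma measurable_simplex m r : measurable (simplex m r).
Proof.
rewrite (_ : simplex m r = tbox (fun=> `[0, +oo[%classic) `&`
    [set t | \sum_(k < m) (tnth t k : R) <= r]).
  apply: measurableI; first by apply: measurable_tbox.
  have mf : measurable_fun setT (fun t : RT R m => \sum_(k < m) (tnth t k : R)).
    by apply: measurable_sum => k; exact: measurable_tnth.
  have := mf measurableT `]-oo, r]%classic (measurable_itv _); rewrite setTI.
  by congr measurable; apply/seteqP; split => t; rewrite /= in_itv.
apply/seteqP; split => t /= [H1 H2]; split => // k; have := H1 k;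
  by rewrite /= in_itv/= andbT.
Qed.

Lemma simplex_neg m r : r < 0 -> simplex m r = set0.
Proof.
move=> r0; rewrite -subset0 => t [t0]; rewrite leNgt (lt_le_trans r0)//.
exact: sumr_ge0.
Qed.

Lemma simplex_scale m r : 0 < r -> leb (simplex m r) = ((r ^+ m)%R%:E * leb (simplex m 1))%E.
Proof.
move=> r0; rewrite (leb_scale (c := r)) ?gt_eqF//; last exact: measurable_simplex.
rewrite gtr0_norm//; congr (_ * leb _)%E; apply/seteqP; split => t /=.
  move=> [t0 t1]; split.
    by move=> k; have := t0 k; rewrite tnth_mktuple pmulr_rge0.
  by move: t1; under eq_bigr do rewrite tnth_mktuple; rewrite -mulr_sumr ger_pMr.
move=> [t0 t1]; split.
  by move=> k; rewrite tnth_mktuple mulr_ge0// ltW.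
by under eq_bigr do rewrite tnth_mktuple; rewrite -mulr_sumr ger_pMr.
Qed.

Lemma simplex_zero m : (0 < m)%N -> leb (simplex m 0) = 0%E.
Proof.
move=> m0; apply/eqP; rewrite eq_le -{2}leb_sigma_app measure_ge0 andbT.
apply: (@le_trans _ _ (leb (tbox (fun _ : 'I_m => [set (0:R)])))).
  rewrite -!leb_sigma_app; apply: le_measure; rewrite ?inE; first exact: measurable_simplex.
    by apply: measurable_tbox => k; exact: measurable_set1.
  move=> t [t0 t1] k /=; apply/eqP; rewrite eq_le t0 andbT.
  by apply: le_trans t1; rewrite (bigD1 k)//= lerDl sumr_ge0.
rewrite leb_box; last by move=> k; exact: measurable_set1.
case: m m0 => // m _.
by rewrite big_ord_recl lebesgue_measure_set1 mul0e.
Qed.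

Lemma leb_simplex0 m r : (m = 0)%N -> 0 <= r -> leb (simplex m r) = 1%E.
Proof.
move=> m0 r0; apply: leb_dim0 => //.
exists [tuple (0:R) | k < m]; split; first by move=> k; rewrite tnth_mktuple.
by under eq_bigr do rewrite tnth_mktuple; rewrite big1.
Qed.

(** Fixing the first coordinate x of the unit simplex leaves a simplex of size 1 - x, so the
    induction step is the integral of (1 - x)^m over [0, 1]; other sizes follow by scaling. *)
Lemma leb_simplex m r : 0 <= r -> leb (simplex m r) = (r ^+ m / m`!%:R)%:E.
Proof.
have simplex1 : leb (simplex m 1) = (m`!%:R^-1)%:E; last first.
  rewrite le_eqVlt => /predU1P[<-|r0]; last first.
    by rewrite simplex_scale// simplex1 -EFinM.
  (* At size 0 the value 0^m / m! is 1 for the one-point space and 0 in positive dimension. *)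
  have [m0|m0] := posnP m; last by rewrite simplex_zero// expr0n gtn_eqF// mul0r.
  by rewrite leb_simplex0// m0 expr0 fact0 divr1.
elim: m => [|m IH].
  by rewrite leb_simplex0// fact0 invr1.
have sliceE x : slice (simplex m.+1 1) x = if 0 <= x then simplex m (1 - x) else set0.
  case: ifPn => x0; last first.
    by rewrite -subset0 => t [/(_ ord0)]; rewrite tnth_tcons0/= (negbTE x0).
  apply/seteqP; split => t [].
    move=> H; rewrite big_ord_recl tnth_tcons0 => H1; split.
      by move=> k; have := H (lift ord0 k); rewrite tnth_tconsS.
    by rewrite lerBrDl; under eq_bigr do rewrite -[tnth t _]/(tnth (x, t).2 _) -tnth_tconsS.
  move=> H1 H2; split.
    move=> k; case: (unliftP ord0 k) => [j|] ->; rewrite ?tnth_tconsS ?tnth_tcons0//=.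
  rewrite big_ord_recl tnth_tcons0 -lerBrDl.
  by under eq_bigr do rewrite tnth_tconsS.
rewrite leb_slice; last exact: measurable_simplex.
transitivity (\int[@lebesgue_measure R]_(x in `[0%R, 1%R]) ((m`!%:R^-1)%:E * (((1 - x) ^+ m)%R)%:E))%E.
  rewrite [RHS]integral_mkcond; apply: eq_integral => x _.
  rewrite patchE; case: ifPn => [|/negP]; rewrite inE/= in_itv/=.
    move=> /andP[x0 x1]; rewrite sliceE x0 leb_sigma_app.
    have [x_lt1|x_ge1] := ltP x 1.
      by rewrite simplex_scale ?subr_gt0// IH -!EFinM mulrC.
    have -> : x = 1 by apply/eqP; rewrite eq_le x1.
    rewrite subrr; have [m0|m0] := posnP m.
      by rewrite leb_simplex0// m0 fact0 expr0 invr1 mule1.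
    by rewrite simplex_zero// expr0n gtn_eqF// mule0.
  move=> x01; rewrite sliceE; case: ifPn => x0; last by rewrite measure0.
  rewrite simplex_neg ?measure0// subr_lt0 ltNge; apply/negP => x1.
  by rewrite x0 x1 in x01.
have mX : measurable_fun (`[0, 1]%classic : set (measurableTypeR R))
    (fun x : measurableTypeR R => ((1 - x) ^+ m)%:E).
  apply/measurable_EFinP; apply: measurable_funX; apply: measurable_funB => //.
have iX : (\int[@lebesgue_measure R]_(x in `[0%R, 1%R]) (((1 - x) ^+ m)%R)%:E)%E = (m.+1%:R^-1)%:E.
  have := @Rintegral_onemXn R m; rewrite /Rintegral => <-; rewrite fineK//.
  have c : {within `[0%R, 1%R], continuous (fun x : R => (1 - x) ^+ m)}.
    by apply: continuous_in_subspaceT => x x01; exact: continuous_onemXn.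
  apply: integrable_fin_num => //.
  by have := continuous_compact_integrable (@segment_compact _ _ _) c.
rewrite ge0_integralZl_EFin//; last first.
  by move=> x /=; rewrite in_itv/= lee_fin => /andP[_ x1]; rewrite exprn_ge0// subr_ge0.
by rewrite iX -EFinM factS natrM invfM mulrC.
Qed.

End simplex.
Arguments simplex {R} m r.

(** * Layers of the fibre volume *)

Section chebyshev.
Local Open Scope ereal_scope.
Context d (T : measurableType d) (R : realType).
Variables (mu : {measure set T -> \bar R}) (D : set T).
Hypothesis mD : measurable D.

(** The last hypothesis says, without division, that u / o and w vary in opposite directions. Its
    integral over pairs (s, t) is twice the claim, and is taken one variable at a time. *)
Lemma chebyshev_integral (u w o : T -> R) :
  measurable_fun D u -> measurable_fun D w -> measurable_fun D o ->
  (forall s, D s -> 0 <= u s)%R -> (forall s, D s -> 0 <= w s)%R ->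
  (forall s, D s -> 0 <= o s)%R ->
  (forall s t, D s -> D t ->
     (u s * o t - u t * o s) * (w s - w t) <= 0)%R ->
  \int[mu]_(s in D) (o s)%:E * \int[mu]_(s in D) (u s * w s)%:E <=
  \int[mu]_(s in D) (u s)%:E * \int[mu]_(s in D) (o s * w s)%:E.
Proof.
move=> mu_ mw mo u0 w0 o0 H.
set O := \int[mu]_(s in D) (o s)%:E; set P := \int[mu]_(s in D) (u s * w s)%:E.
set U := \int[mu]_(s in D) (u s)%:E; set Q := \int[mu]_(s in D) (o s * w s)%:E.
have muw : measurable_fun D (fun s => u s * w s)%R by exact: measurable_funM.
have mow : measurable_fun D (fun s => o s * w s)%R by exact: measurable_funM.
have uw0 s : D s -> (0 <= u s * w s)%R by move=> Ds; rewrite mulr_ge0 ?u0 ?w0.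
have ow0 s : D s -> (0 <= o s * w s)%R by move=> Ds; rewrite mulr_ge0 ?o0 ?w0.
have ge0int (f : T -> R) : (forall s, D s -> 0 <= f s)%R -> 0 <= \int[mu]_(s in D) (f s)%:E.
  by move=> f0; apply: integral_ge0 => s Ds; rewrite lee_fin f0.
have lin2 (f g : T -> R) (a b : \bar R) : measurable_fun D f -> measurable_fun D g ->
    (forall s, D s -> 0 <= f s)%R -> (forall s, D s -> 0 <= g s)%R -> 0 <= a -> 0 <= b ->
    measurable_fun D (fun s => a * (f s)%:E + b * (g s)%:E) /\
    \int[mu]_(s in D) (a * (f s)%:E + b * (g s)%:E) =
    a * \int[mu]_(s in D) (f s)%:E + b * \int[mu]_(s in D) (g s)%:E.
  move=> mf mg f0 g0 a0 b0.
  have mf' : measurable_fun D (fun s => a * (f s)%:E).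
    by apply: measurable_funeM; exact/measurable_EFinP.
  have mg' : measurable_fun D (fun s => b * (g s)%:E).
    by apply: measurable_funeM; exact/measurable_EFinP.
  split; first exact: emeasurable_funD.
  have f0' s : D s -> 0 <= (f s)%:E by move=> Ds; rewrite lee_fin f0.
  have g0' s : D s -> 0 <= (g s)%:E by move=> Ds; rewrite lee_fin g0.
  have mfE : measurable_fun D (EFin \o f) by exact/measurable_EFinP.
  have mgE : measurable_fun D (EFin \o g) by exact/measurable_EFinP.
  rewrite -(ge0_integralZl _ mD mfE)// -(ge0_integralZl _ mD mgE)// -ge0_integralD//.
  - by move=> s Ds; rewrite mule_ge0// f0'.
  - by move=> s Ds; rewrite mule_ge0// g0'.
(* The hypothesis integrated in t, with the negative terms moved across so that only nonnegative
   functions are integrated. *)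
have inner s : D s -> O * (u s * w s)%:E + P * (o s)%:E <= Q * (u s)%:E + U * (o s * w s)%:E.
  move=> Ds.
  have us0 : 0 <= (u s)%:E by rewrite lee_fin u0.
  have os0 : 0 <= (o s)%:E by rewrite lee_fin o0.
  have uws0 : 0 <= (u s * w s)%:E by rewrite lee_fin uw0.
  have ows0 : 0 <= (o s * w s)%:E by rewrite lee_fin ow0.
  have [m1 e1] := lin2 _ _ _ _ mo muw o0 uw0 uws0 os0.
  have [m2 e2] := lin2 _ _ _ _ mow mu_ ow0 u0 us0 ows0.
  rewrite ![_ * (_ s)%:E]muleC ![_ * (_ * _)%:E]muleC -e1 -e2.
  apply: ge0_le_integral => //.
    by move=> t Dt; rewrite adde_ge0// mule_ge0// lee_fin ?o0 ?uw0.
  move=> t Dt; rewrite -!EFinM -!EFinD lee_fin -subr_le0.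
  apply: le_trans (H _ _ Ds Dt); rewrite le_eqVlt; apply/orP; left; apply/eqP; ring.
have [m1 e1] := lin2 _ _ O P muw mo uw0 o0 (ge0int _ o0) (ge0int _ uw0).
have [m2 e2] := lin2 _ _ Q U mu_ mow u0 ow0 (ge0int _ ow0) (ge0int _ u0).
have : \int[mu]_(s in D) (O * (u s * w s)%:E + P * (o s)%:E) <=
       \int[mu]_(s in D) (Q * (u s)%:E + U * (o s * w s)%:E).
  apply: ge0_le_integral => //.
  move=> s Ds; rewrite adde_ge0// mule_ge0 ?ge0int// lee_fin; [exact: uw0|exact: o0].
rewrite e1 e2 -/P -/O -/U -/Q (muleC P) (muleC Q).
(* 2 O P <= 2 Q U is halved; infinite values are treated apart. *)
rewrite (muleC U Q); move: (O * P) (Q * U) => [x| |] [y| |]//=.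
- by rewrite -!EFinD !lee_fin => xy; lra.
- by move=> _; rewrite leey.
- by move=> _; rewrite leNye.
Qed.

End chebyshev.

Section layers.
Context {R : realType} {n : nat}.
Implicit Types (I J S : {set 'I_n}) (K : set 'rV[R]_n).

(** The base point [v] is taken in the ambient space, so that a single function gives the fibre
    volumes over R^S for every S disjoint from J. *)
Definition fiber J K (v : 'rV[R]_n) : \bar R :=
  leb_sigma #|J| [set x | K (emb x + v)].

Lemma measurable_fiber J K d (T : measurableType d) (f : T -> 'rV[R]_n) :
  borel K -> (forall k, measurable_fun setT (fun t => f t 0 k : measurableTypeR R)) ->
  measurable_fun setT (fun t => fiber J K (f t)).
Proof.
move=> bK mf; apply: (@measurable_section1 _ _ _ _ _ _ [set p : T * RT R #|J| | K (emb p.2 + f p.1)]).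
apply: (borel_preimage _ bK) => k.
rewrite (_ : (fun t => _) = (fun p : T * RT R #|J| => emb p.2 0 k + f p.1 0 k)); last first.
  by apply/funext => p; rewrite mxE.
apply: measurable_funD.
  by apply: (@measurableT_comp _ _ _ _ _ _ (fun t : RT R #|J| => emb t 0 k : measurableTypeR R)) => //; exact: measurable_emb.
by apply: (@measurableT_comp _ _ _ _ _ _ (fun t => f t 0 k : measurableTypeR R)).
Qed.

Lemma measurable_layer S J K (c : R) (X : set (measurableTypeR R)) : borel K ->
  measurable_fun X (fun s : measurableTypeR R =>
    leb [set y : RT R #|S| | s%:E <= c%:E * fiber J K (emb y)]%E).
Proof.
move=> bK; apply: measurable_funTS.
under eq_fun do rewrite -leb_sigma_app.
apply: measurable_level; apply: measurable_funeM.
by apply: measurable_fiber => // k; exact: measurable_emb.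
Qed.

(** Slicing along R^J, then layer cake. The factor c is meant to be the inverse of the largest fibre
    volume, so that only levels up to 1 count. The formula serves both for K and for the standard
    simplex. *)
Lemma layer_formula I J S K (c : R) : [disjoint S & J]%B -> (S :|: J)%SET = I ->
  borel K -> 0 < c -> (forall y : RT R #|S|, (c%:E * fiber J K (emb y) <= 1)%E) ->
  (c%:E * leb [set t : RT R #|I| | K (emb t)] =
  \int[@lebesgue_measure R]_(s in `]0%R, 1%R[)
    leb [set y : RT R #|S| | s%:E <= c%:E * fiber J K (emb y)])%E.
Proof.
move=> dSJ SJ bK c0 fK1.
have mf : measurable_fun setT (fun y : RT R #|S| => fiber J K (emb y)).
  by apply: measurable_fiber => // k; exact: measurable_emb.
have mcf : measurable_fun setT (fun y : RT R #|S| => (c%:E * fiber J K (emb y))%E).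
  exact: measurable_funeM.
rewrite (leb_split dSJ SJ bK) product_measure1_section.
have cf0 v : (0 <= c%:E * fiber J K v)%E by rewrite mule_ge0// lee_fin ltW.
transitivity (\int[leb_sigma #|S|]_y (c%:E * fiber J K (emb y)))%E.
  rewrite ge0_integralZl_EFin ?(ltW c0)//; congr (_ * _)%E.
  by apply: eq_integral => y _; congr (leb_sigma _ _); apply/seteqP; split => x /=;
    rewrite addrC.
rewrite layer_cake//.
under eq_integral => s _ do rewrite leb_sigma_app.
pose g s := leb [set y : RT R #|S| | (s%:E <= c%:E * fiber J K (emb y))%E].
have mg (X : set (measurableTypeR R)) : measurable_fun X g.
  exact: measurable_layer.
transitivity (\int[@lebesgue_measure R]_(s in `]0%R, 1%R]) g s)%E.
  rewrite integral_mkcond [RHS]integral_mkcond; apply: eq_integral => s _.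
  rewrite !patchE !mem_setE !in_itv/= andbT.
  have [s0|//] := ltP 0%R s; have [//|s1] := leP s 1%R.
  rewrite (_ : mkset _ = set0) -?leb_sigma_app ?measure0// -subset0 => y /= /le_trans H.
  by have := H _ (fK1 _); rewrite lee_fin leNgt s1.
(* The endpoint is discarded so that 1 - s^(1/N) is positive on the whole domain of integration. *)
apply/esym/(@integral_itv_bndo_bndc R (BRight 0) 1 g); exact: mg.
Qed.

End layers.

Section embedding_algebra.
Context {R : realType} {n : nat}.
Implicit Types (I J S : {set 'I_n}).

Lemma emb_scale I c (t : RT R #|I|) : emb (tscale c t) = c *: emb t.
Proof.
apply/rowP => j; rewrite mxE; have [jI|jI] := boolP (j \in I).
  by rewrite -(enum_rankK_in jI jI) !emb_enum_val tnth_mktuple.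
by rewrite !emb_notin// mulr0.
Qed.

Lemma emb_add I (t t' : RT R #|I|) : emb (tadd t t') = emb t + emb t'.
Proof.
apply/rowP => j; rewrite mxE; have [jI|jI] := boolP (j \in I).
  by rewrite -(enum_rankK_in jI jI) !emb_enum_val tnth_mktuple.
by rewrite !emb_notin// addr0.
Qed.

Lemma sum_emb I (t : RT R #|I|) : \sum_j emb t 0 j = \sum_k (tnth t k : R).
Proof.
rewrite (bigID (mem I))/= [X in _ + X]big1 ?addr0; last by move=> j; exact: emb_notin.
by rewrite big_enum_val; apply: eq_bigr => k _; rewrite emb_enum_val.
Qed.

Lemma emb_ge0 I (t : RT R #|I|) :
  (forall j, 0 <= emb t 0 j) <-> (forall k, 0 <= (tnth t k : R)).
Proof.
split=> [H k|H j]; first by rewrite -emb_enum_val.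
have [jI|jI] := boolP (j \in I).
  by rewrite -(enum_rankK_in jI jI) emb_enum_val.
by rewrite emb_notin.
Qed.

Lemma emb_addl S J (y : RT R #|S|) (x : RT R #|J|) j : [disjoint S & J]%B ->
  j \in J -> (emb x + emb y) 0 j = emb x 0 j.
Proof. by move=> dSJ jJ; rewrite mxE (@emb_notin _ _ S) ?addr0// (disjointFl dSJ). Qed.

Lemma emb_addr S J (y : RT R #|S|) (x : RT R #|J|) j : [disjoint S & J]%B ->
  j \notin J -> (emb x + emb y) 0 j = emb y 0 j.
Proof. by move=> dSJ jJ; rewrite mxE (@emb_notin _ _ J) ?add0r. Qed.

Lemma emb_add_ge0 S J (y : RT R #|S|) (x : RT R #|J|) : [disjoint S & J]%B ->
  (forall j, 0 <= (emb x + emb y) 0 j) ->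
  (forall k, 0 <= (tnth x k : R)) /\ (forall k, 0 <= (tnth y k : R)).
Proof.
move=> dSJ H; split; apply/emb_ge0 => j.
  have [jJ|jJ] := boolP (j \in J); last by rewrite emb_notin.
  by rewrite -(emb_addl y x dSJ jJ).
have [jJ|jJ] := boolP (j \in J); first by rewrite emb_notin ?(disjointFl dSJ).
by rewrite -(emb_addr y x dSJ jJ).
Qed.

Definition std_simplex : set 'rV[R]_n :=
  [set v | (forall j, 0 <= v 0 j) /\ \sum_j v 0 j <= 1].

Lemma borel_std_simplex : borel std_simplex.
Proof.
rewrite /borel (_ : mkset _ = simplex n 1); first exact: measurable_simplex.
apply/seteqP; split => t [t0 t1]; split.
- by move=> k; have := t0 k; rewrite mxE.
- by move: t1; under eq_bigr do rewrite mxE.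
- by move=> k; rewrite mxE.
- by under eq_bigr do rewrite mxE.
Qed.

Lemma leb_std_simplex I :
  leb [set t : RT R #|I| | std_simplex (emb t)] = ((#|I|)`!%:R^-1)%:E.
Proof.
rewrite (_ : mkset _ = simplex #|I| 1) ?leb_simplex ?expr1n ?div1r//.
apply/seteqP; split => t [t0 t1].
  by split; [exact/emb_ge0|rewrite -sum_emb].
by split; [exact/emb_ge0|rewrite sum_emb].
Qed.

Lemma fiber_std_simplex S J (y : RT R #|S|) : [disjoint S & J]%B ->
  (forall k, 0 <= (tnth y k : R)) ->
  fiber J std_simplex (emb y) = leb (simplex #|J| (1 - \sum_k (tnth y k : R))).
Proof.
move=> dSJ y0; rewrite /fiber leb_sigma_app; congr leb; apply/seteqP; split => x [].
  move=> /(emb_add_ge0 dSJ)[x0 _].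
  under eq_bigr do rewrite mxE; rewrite big_split/= !sum_emb => H.
  by split => //; rewrite lerBrDr.
move=> x0 x1; split => /=.
  have /emb_ge0 xe := x0; have /emb_ge0 ye := y0.
  by move=> j; rewrite mxE addr_ge0.
by under eq_bigr do rewrite mxE; rewrite big_split/= !sum_emb -lerBrDr.
Qed.

Lemma fiber_std_simplex_neg S J (y : RT R #|S|) : [disjoint S & J]%B ->
  ~ (forall k, 0 <= (tnth y k : R)) -> fiber J std_simplex (emb y) = 0%E.
Proof.
move=> dSJ y0; rewrite /fiber (_ : mkset _ = set0) ?measure0// -subset0.
by move=> x [/(emb_add_ge0 dSJ)[_]].
Qed.

(** The integral is not computed by calculus: it is the layer formula for the standard simplex,
    whose layer at level s over R^S is a simplex of size 1 - s^(1/N). *)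
Lemma beta_layer S J : [disjoint S & J]%B -> (0 < #|J|)%N ->
  (\int[@lebesgue_measure R]_(s in `]0%R, 1%R[)
     ((1 - s `^ #|J|%:R^-1) ^+ #|S| / (#|S|)`!%:R)%R%:E)%E =
  ((#|J|)`!%:R / (#|S| + #|J|)`!%:R)%:E.
Proof.
move=> dSJ N0; set N := #|J|; set m := #|S|.
have Nf : (0 : R) < N`!%:R by rewrite ltr0n fact_gt0.
(* N! is the inverse of the volume of the N-dimensional simplex, which is the largest fibre. *)
have := @layer_formula _ _ _ J S std_simplex N`!%:R dSJ erefl borel_std_simplex Nf.
rewrite leb_std_simplex cardsU (_ : (S :&: J)%SET = finset.set0) ?cards0 ?subn0; last first.
  by apply/eqP; rewrite setI_eq0.
rewrite -EFinM => -> //; last first.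
  move=> y; have [y0|y0] := pselect (forall k, 0 <= (tnth y k : R)); last first.
    by rewrite fiber_std_simplex_neg// mule0.
  rewrite fiber_std_simplex//; have [y1|y1] := leP 0 (1 - \sum_k (tnth y k : R)).
    rewrite leb_simplex// -EFinM lee_fin mulrCA divff ?gt_eqF// mulr1.
    by rewrite exprn_ile1// gerBl sumr_ge0.
  by rewrite simplex_neg// -leb_sigma_app measure0 mule0.
apply: eq_integral => s; rewrite inE/= in_itv/= => /andP[s0 s1].
have rN : (s `^ N%:R^-1) ^+ N = s.
  by rewrite -powR_mulrn ?powR_ge0// -powRrM mulVf ?powRr1 ?(ltW s0)// pnatr_eq0 -lt0n.
have r1 : s `^ N%:R^-1 < 1.
  by rewrite ltNge; apply/negP => r1; have := exprn_ege1 N r1; rewrite rN leNgt s1.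
rewrite -leb_simplex ?subr_ge0 ?(ltW r1)//; congr leb; apply/seteqP; split => y.
  move=> [y0 y1] /=; rewrite fiber_std_simplex//.
  have y2 : s `^ N%:R^-1 <= 1 - \sum_k (tnth y k : R) by rewrite lerBrDl -lerBrDr.
  rewrite leb_simplex ?(le_trans (powR_ge0 _ _) y2)// -EFinM lee_fin.
  by rewrite mulrCA divff ?gt_eqF// mulr1 -[leLHS]rN lerXn2r ?nnegrE ?powR_ge0 ?(le_trans (powR_ge0 _ _) y2).
move=> /=; have [y0|y0] := pselect (forall k, 0 <= (tnth y k : R)); last first.
  by rewrite fiber_std_simplex_neg// mule0 lee_fin leNgt s0.
rewrite fiber_std_simplex//; have [y1|y1] := leP 0 (1 - \sum_k (tnth y k : R)); last first.
  by rewrite simplex_neg// -leb_sigma_app measure0 mule0 lee_fin leNgt s0.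
rewrite leb_simplex// -EFinM lee_fin mulrCA divff ?gt_eqF// mulr1 -[leLHS]rN.
rewrite ler_pXn2r ?nnegrE ?powR_ge0// => y2; split => //.
by rewrite lerBrDl -lerBrDr.
Qed.

End embedding_algebra.

(** * Fibres of down-closed convex bodies *)

Section corner_bodies.
Context {R : realType} {n : nat}.
Implicit Types (I J S Y Z : {set 'I_n}) (K : set 'rV[R]_n).

(** What the volume estimates use of an anti-blocking body; [B] bounds its coordinates. A projection
    of x lies below x, hence in K, so projections can be measured as sections [K (emb x)]. *)
Definition corner_body (B : R) K :=
  [/\ borel K, forall x, K x -> forall k, 0 <= x 0 k <= B,
    forall x (y : 'rV[R]_n), K x -> (forall k, 0 <= y 0 k <= x 0 k) -> K y,
    forall x y t, K x -> K y -> 0 <= t <= 1 -> K (t *: x + (1 - t) *: y) & K 0].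

Variables (B : R) (K : set 'rV[R]_n).
Hypothesis cK : corner_body B K.

Let bK : borel K. Proof. by case: cK. Qed.
Let K_bound x : K x -> forall k, 0 <= x 0 k <= B. Proof. by case: cK => _ H _ _ _; exact: H. Qed.
Let K_down x (y : 'rV[R]_n) : K x -> (forall k, 0 <= y 0 k <= x 0 k) -> K y.
Proof. by case: cK => _ _ H _ _; exact: H. Qed.
Let K_conv x y t : K x -> K y -> 0 <= t <= 1 -> K (t *: x + (1 - t) *: y).
Proof. by case: cK => _ _ _ H _; exact: H. Qed.
Let K0 : K 0. Proof. by case: cK. Qed.

Lemma fiber_set_down_closed S J (y : RT R #|S|) : [disjoint S & J]%B ->
  down_closed B [set x : RT R #|J| | K (emb x + emb y)].
Proof.
move=> dSJ; split.
- apply: (borel_preimage _ bK) => k.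
  rewrite (_ : (fun t => _) = (fun x : RT R #|J| => emb x 0 k + emb y 0 k)); last first.
    by apply/funext => x; rewrite mxE.
  by apply: measurable_funD => //; exact: measurable_emb.
- move=> x Kx k; have := K_bound Kx (enum_val k).
  by rewrite emb_addl ?enum_valP// emb_enum_val.
- move=> x x' Kx xx'; apply: (K_down Kx) => k.
  have [kJ|kJ] := boolP (k \in J).
    by rewrite !emb_addl// -(enum_rankK_in kJ kJ) !emb_enum_val.
  by rewrite !emb_addr// lexx andbT; have := K_bound Kx k; rewrite emb_addr// => /andP[].
Qed.

Lemma emb0 I : emb [tuple (0 : R) | k < #|I|] = 0 :> 'rV[R]_n.
Proof.
apply/rowP => j; rewrite mxE; have [jI|jI] := boolP (j \in I).
  by rewrite -(enum_rankK_in jI jI) emb_enum_val tnth_mktuple.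
by rewrite emb_notin.
Qed.

Lemma section_down_closed J : down_closed B [set x : RT R #|J| | K (emb x)].
Proof.
have d0 : [disjoint finset.set0 & J]%B by rewrite -setI_eq0 finset.set0I.
have := fiber_set_down_closed [tuple (0 : R) | k < #|finset.set0|] d0.
rewrite emb0; congr (down_closed _ _).
by apply/seteqP; split => x /=; rewrite addr0.
Qed.

Lemma section_fin J : (leb [set x : RT R #|J| | K (emb x)] < +oo)%E.
Proof. exact: down_closed_fin (section_down_closed J). Qed.

Lemma fiber0 J : fiber J K 0 = leb [set x : RT R #|J| | K (emb x)].
Proof.
by rewrite /fiber leb_sigma_app; congr leb; apply/seteqP; split => x /=; rewrite addr0.
Qed.

Lemma fiber_le0 S J (y : RT R #|S|) : [disjoint S & J]%B ->
  (fiber J K (emb y) <= fiber J K 0)%E.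
Proof.
move=> dSJ; have [m1 _ _] := fiber_set_down_closed y dSJ.
apply: le_measure; rewrite ?inE//.
  rewrite (_ : mkset _ = [set x : RT R #|J| | K (emb x)]); last first.
    by apply/seteqP; split => x /=; rewrite addr0.
  by have [] := section_down_closed J.
move=> x /= Kx; rewrite addr0; apply: (K_down Kx) => k.
have [x0 _] := emb_add_ge0 dSJ (fun j => proj1 (andP (K_bound Kx j))).
have /emb_ge0 -> /= := x0.
have := K_bound Kx k; have [kJ|kJ] := boolP (k \in J); first by rewrite emb_addl.
by rewrite emb_notin// => /andP[].
Qed.

(** By convexity the fibre over l y contains l times the fibre over y plus 1 - l times the fibre
    over 0. *)
Lemma fiber_brunn_minkowski S J (y : RT R #|S|) (l a b : R) :
  [disjoint S & J]%B -> 0 < l < 1 -> 0 <= a -> 0 <= b ->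
  [set x : RT R #|J| | K (emb x + emb y)] !=set0 ->
  ((a ^+ #|J|)%:E <= fiber J K (emb y))%E -> ((b ^+ #|J|)%:E <= fiber J K 0)%E ->
  (((l * a + (1 - l) * b) ^+ #|J|)%:E <= fiber J K (emb (tscale l y)))%E.
Proof.
move=> dSJ /andP[l0 l1] a0 b0 ne; rewrite fiber0 /fiber !leb_sigma_app => ay bJ.
have l1' : 0 < 1 - l by rewrite subr_gt0.
(* The dilate c D is written as the set of x with D (c^-1 x); c <= 1 keeps it inside the cube of
   side B. *)
have scaled (D : set (RT R #|J|)) (c e : R) : 0 < c <= 1 -> down_closed B D -> D !=set0 ->
    0 <= e -> ((e ^+ #|J|)%:E <= leb D)%E ->
    [/\ down_closed B [set x | D (tscale c^-1 x)],
        [set x | D (tscale c^-1 x)] !=set0 &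
        (((c * e) ^+ #|J|)%:E <= leb [set x | D (tscale c^-1 x)])%E].
  move=> /andP[c0 c1] [mD bD dD] [x Dx] e0 eD.
  have mD' : measurable [set x | D (tscale c^-1 x)].
    by rewrite -[X in measurable X]setTI; exact: measurable_tscale.
  split.
  - split => //.
      move=> t Dt k; have := bD _ Dt k; rewrite tnth_mktuple.
      rewrite pmulr_rge0 ?invr_gt0// ler_pdivrMl// => /andP[-> /le_trans]; apply.
      have /andP[x0 xB] := bD _ Dx k.
      by rewrite ler_piMl// (le_trans x0).
    move=> t t' Dt tt'; apply: (dD _ _ Dt) => k; rewrite !tnth_mktuple.
    have /andP[t0 t1] := tt' k.
    by rewrite mulr_ge0 ?invr_ge0 ?(ltW c0)//= ler_pM2l// invr_gt0.
  - exists (tscale c x) => /=; rewrite (_ : tscale _ _ = x)//.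
    by apply: eq_from_tnth => k; rewrite !tnth_mktuple mulKf// gt_eqF.
  - move: eD; rewrite (leb_scale (c := c^-1) _ mD) ?invr_neq0 ?gt_eqF//.
    rewrite gtr0_norm ?invr_gt0// exprVn lee_pdivlMl ?exprn_gt0// -EFinM.
    by rewrite exprMn.
have [dA nA aA] := scaled _ l a ltac:(by rewrite l0 ltW) (fiber_set_down_closed y dSJ) ne a0 ay.
have ne0 : [set x : RT R #|J| | K (emb x)] !=set0.
  by exists [tuple (0:R) | k < #|J|]; rewrite /= emb0.
have [dB nB bB] := scaled _ (1 - l) b ltac:(by rewrite l1' gerBl ltW) (section_down_closed J) ne0 b0 bJ.
apply: (brunn_minkowski dA dB _ nA nB) aA bB; rewrite ?mulr_ge0 ?(ltW l0) ?(ltW l1')//.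
  by have [] := fiber_set_down_closed (tscale l y) dSJ.
move=> t t' /= At Bt'.
have l01 : 0 <= l <= 1 by rewrite (ltW l0) (ltW l1).
have := K_conv At Bt' l01.
rewrite emb_add !emb_scale scalerDr !scalerA divff ?gt_eqF// divff ?gt_eqF// !scale1r.
by rewrite addrAC.
Qed.

End corner_bodies.

Section root.
Context {R : realType}.
Variable N : nat.
Hypothesis N0 : (0 < N)%N.
Local Notation root s := (s `^ N%:R^-1).

Lemma rootXn (s : R) : 0 <= s -> root s ^+ N = s.
Proof.
move=> s0; rewrite -powR_mulrn ?powR_ge0// -powRrM mulVf ?powRr1//.
by rewrite pnatr_eq0 -lt0n.
Qed.

Lemma ltr_root (s t : R) : 0 <= s -> s < t -> root s < root t.
Proof.
move=> s0 st; rewrite ltNge; apply/negP => ts.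
have : root t ^+ N <= root s ^+ N by rewrite lerXn2r ?nnegrE ?powR_ge0.
by rewrite !rootXn ?(le_trans s0 (ltW st))// leNgt st.
Qed.

Lemma root_lt1 (s : R) : 0 <= s -> s < 1 -> root s < 1.
Proof. by move=> s0 /(ltr_root s0); rewrite powR1. Qed.

Lemma measurable_onem_root m (X : set (measurableTypeR R)) :
  measurable_fun X (fun s : measurableTypeR R => (1 - root s) ^+ m : R).
Proof.
apply: measurable_funTS; apply: measurable_funX; exact: measurable_funB.
Qed.

End root.

(** * Layers of K: growth in the level and product bound *)

Section volume_inequality.
Context {R : realType} {n : nat}.
Implicit Types (I J S Y Z : {set 'I_n}).
Variables (B : R) (K : set 'rV[R]_n).
Hypothesis cK : corner_body B K.

Let bK : borel K. Proof. by case: cK. Qed.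
Let K_bound x : K x -> forall k, 0 <= x 0 k <= B. Proof. by case: cK => _ H _ _ _; exact: H. Qed.
Let K_down x (y : 'rV[R]_n) : K x -> (forall k, 0 <= y 0 k <= x 0 k) -> K y.
Proof. by case: cK => _ _ H _ _; exact: H. Qed.

Lemma volE I : (vol I K)%:E = leb [set t : RT R #|I| | K (emb t)].
Proof.
rewrite /vol fineK// ge0_fin_numE ?(section_fin cK)//.
by rewrite -leb_sigma_app measure_ge0.
Qed.

Lemma vol_ge0 I : 0 <= vol I K.
Proof. by rewrite -lee_fin volE -leb_sigma_app measure_ge0. Qed.

Variables (J : {set 'I_n}) (c : R).
Hypotheses (J_gt0 : (0 < #|J|)%N) (volJ_gt0 : 0 < vol J K) (cE : c = (vol J K)^-1).

Local Notation root s := (s `^ #|J|%:R^-1).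
Local Notation layer S s := [set y : RT R #|S| | (s%:E <= c%:E * fiber J K (emb y))%E].

Let c_gt0 : 0 < c. Proof. by rewrite cE invr_gt0. Qed.

Lemma measurable_layer_set S s : measurable (layer S s).
Proof.
rewrite -[layer S s]setTI; apply: emeasurable_fun_c_infty => //.
apply: measurable_funeM; apply: measurable_fiber => // k.
exact: measurable_emb.
Qed.

Lemma fiber_le1 S (y : RT R #|S|) : [disjoint S & J]%B ->
  (c%:E * fiber J K (emb y) <= 1)%E.
Proof.
move=> dSJ; rewrite cE lee_pdivrMl// mule1.
by rewrite (le_trans (fiber_le0 cK y dSJ))// fiber0 volE.
Qed.

Lemma layer_nonempty_fiber S s (y : RT R #|S|) : 0 < s -> layer S s y ->
  [set x : RT R #|J| | K (emb x + emb y)] !=set0.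
Proof.
move=> s0 sy; apply/set0P/eqP => f0; move: sy.
by rewrite /= /fiber f0 measure0 mule0 lee_fin leNgt s0.
Qed.

(** At a positive level the fibre over y is nonempty, so y lies in the section of K by R^S, which
    has finite volume. *)
Lemma layer_fin S s : [disjoint S & J]%B -> 0 < s -> (leb (layer S s) < +oo)%E.
Proof.
move=> dSJ s0; apply: le_lt_trans (section_fin cK S).
rewrite -!leb_sigma_app; apply: le_measure; rewrite ?inE.
- exact: measurable_layer_set.
- by have [] := section_down_closed cK S.
- move=> y /(layer_nonempty_fiber s0)[x /= Kx]; apply: (K_down Kx) => k.
  have /andP[Kx0 _] := K_bound Kx k.
  have [kJ|kJ] := boolP (k \in J).
    by rewrite [X in 0 <= X <= _]emb_notin ?lexx// (disjointFl dSJ).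
  by rewrite emb_addr// lexx andbT -(emb_addr y x dSJ kJ).
Qed.

Lemma layer_le S s t : s <= t -> (leb (layer S t) <= leb (layer S s))%E.
Proof.
move=> st; rewrite -!leb_sigma_app; apply: le_measure; rewrite ?inE.
- exact: measurable_layer_set.
- exact: measurable_layer_set.
- by move=> y /=; apply: le_trans; rewrite lee_fin.
Qed.

(* The layer at s, contracted by l = (1 - root t) / (1 - root s), is included in
   the layer at t: this is Brunn-Minkowski for the fibres over y and over 0. *)
Lemma layer_growth S s t : [disjoint S & J]%B -> 0 < s -> s < t -> t < 1 ->
  (((1 - root t) ^+ #|S|)%R%:E * leb (layer S s) <=
   ((1 - root s) ^+ #|S|)%R%:E * leb (layer S t))%E.
Proof.
move=> dSJ s0 st t1.
have rst : root s < root t by rewrite ltr_root// ltW.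
have rt1 : root t < 1 by rewrite root_lt1// ltW// (lt_trans s0).
have rs1 : root s < 1 by rewrite (lt_trans rst).
have rs' : 0 < 1 - root s by rewrite subr_gt0.
pose l := (1 - root t) / (1 - root s).
have l0 : 0 < l by rewrite divr_gt0// subr_gt0.
have l1 : l < 1 by rewrite ltr_pdivrMr// mul1r ltrD2l ltrN2.
have lE : 1 - root t = l * (1 - root s) by rewrite divfK// gt_eqF.
(* [kappa] is the radius of the fibre over 0, and that of the fibre over y is at least root s *
   kappa. The factor l is chosen so that l * root s + (1 - l) = root t. *)
have [kappa k0 kE] := nth_root J_gt0 (ltW volJ_gt0).
have sub : layer S s `<=` [set y | layer S t (tscale l y)].
  move=> y sy /=; have ne := layer_nonempty_fiber s0 sy.
  have ay : (((root s * kappa) ^+ #|J|)%:E <= fiber J K (emb y))%E.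
    move: sy => /=; rewrite cE lee_pdivlMl// exprMn kE rootXn ?(ltW s0)//.
    by rewrite mulrC EFinM.
  have bJ : ((kappa ^+ #|J|)%:E <= fiber J K 0)%E by rewrite kE fiber0 volE.
  have l01 : 0 < l < 1 by rewrite l0.
  have := fiber_brunn_minkowski cK dSJ l01 (mulr_ge0 (powR_ge0 _ _) k0) k0 ne ay bJ.
  have -> : l * (root s * kappa) + (1 - l) * kappa = root t * kappa.
    have -> : root t = 1 - l * (1 - root s) by rewrite -lE; ring.
    ring.
  rewrite exprMn kE rootXn ?(ltW (lt_trans s0 st))// => H.
  by rewrite cE lee_pdivlMl// -EFinM mulrC.
rewrite (leb_scale (c := l) _ (@measurable_layer_set S t)) ?gt_eqF// gtr0_norm//.
rewrite lE exprMn muleA -EFinM [_ * l ^+ _]mulrC.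
apply: lee_wpmul2l; first by rewrite lee_fin mulr_ge0// exprn_ge0// ltW.
rewrite -!leb_sigma_app; apply: le_measure; rewrite ?inE.
- exact: measurable_layer_set.
- rewrite -[X in measurable X]setTI; apply: measurable_tscale => //.
  exact: measurable_layer_set.
- exact: sub.
Qed.

Lemma fiber_le (v w : 'rV[R]_n) : (forall j, j \in J -> v 0 j = 0) ->
  (forall j, j \in J -> w 0 j = 0) -> (forall j, 0 <= v 0 j <= w 0 j) ->
  (fiber J K w <= fiber J K v)%E.
Proof.
move=> vJ wJ vw.
have mf u : measurable [set x : RT R #|J| | K (emb x + u)].
  apply: (borel_preimage _ bK) => k.
  rewrite (_ : (fun t => _) = (fun x : RT R #|J| => emb x 0 k + u 0 k)); last first.
    by apply/funext => x; rewrite mxE.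
  by apply: measurable_funD => //; exact: measurable_emb.
apply: le_measure; rewrite ?inE; try exact: mf.
move=> x /= Kx; apply: (K_down Kx) => j.
have /andP[v0 v1] := vw j; rewrite !mxE lerD2l v1 andbT.
have [jJ|jJ] := boolP (j \in J); last by rewrite emb_notin// add0r.
by have /andP[+ _] := K_bound Kx j; rewrite mxE vJ// wJ.
Qed.

(** Deleting z or y from the base point y + z enlarges the fibre, so both components of a point of
    the joint layer lie in layers of the same level. *)
Lemma layer_product Y Z s : [disjoint Y & J]%B -> [disjoint Z & J]%B ->
  [disjoint Y & Z]%B -> 0 < s ->
  (leb (layer (Y :|: Z)%SET s) <= leb (layer Y s) * leb (layer Z s))%E.
Proof.
move=> dY dZ dYZ s0.
have bL : borel [set v | s%:E <= c%:E * fiber J K v]%E.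
  rewrite /borel -[X in measurable X]setTI; apply: emeasurable_fun_c_infty => //.
  apply: measurable_funeM; apply: measurable_fiber => // k.
  rewrite (_ : (fun t => _) = (fun t : RT R n => tnth t k)); last first.
    by apply/funext => t; rewrite mxE.
  exact: measurable_tnth.
rewrite (leb_split dYZ erefl bL) -!leb_sigma_app -product_measure1E//; try exact: measurable_layer_set.
apply: le_measure; rewrite ?inE.
- exact: borel_emb2.
- by apply: measurableX; exact: measurable_layer_set.
(* Since s > 0 the fibre is nonempty, and a point of it shows that y and z have nonnegative
   coordinates, as needed to compare fibres. *)
move=> -[y z] /= yz; have yz' : [set x : RT R #|J| | K (emb x + (emb y + emb z))] !=set0.
  apply/set0P/eqP => f0; move: yz.
  by rewrite /fiber f0 measure0 mule0 lee_fin leNgt s0.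
have yz_ge0 j : 0 <= emb y 0 j /\ 0 <= emb z 0 j.
  have [x /= /K_bound /(_ j) /andP[xyz _]] := yz'; move: xyz; rewrite !mxE.
  have [jY|jY] := boolP (j \in Y).
    rewrite [emb x 0 j]emb_notin ?(disjointFr dY)// [emb z 0 j]emb_notin ?(disjointFr dYZ)//.
    by rewrite add0r addr0.
  rewrite [emb y 0 j]emb_notin//; have [jZ|jZ] := boolP (j \in Z).
    by rewrite [emb x 0 j]emb_notin ?(disjointFr dZ)// !add0r.
  by rewrite [emb z 0 j]emb_notin.
have embJ (S : {set 'I_n}) (t : RT R #|S|) j : [disjoint S & J]%B -> j \in J -> emb t 0 j = 0.
  by move=> dS jJ; rewrite emb_notin// (disjointFl dS).
have wJ j : j \in J -> (emb y + emb z) 0 j = 0 by move=> jJ; rewrite mxE !embJ// addr0.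
split; apply: (le_trans yz); apply: lee_wpmul2l; rewrite ?lee_fin ?(ltW c_gt0)//.
  apply: fiber_le => // j; first exact: embJ.
  by have [y0 z0] := yz_ge0 j; rewrite mxE y0 lerDl z0.
apply: fiber_le => // j; first exact: embJ.
by have [y0 z0] := yz_ge0 j; rewrite mxE z0 lerDr y0.
Qed.

End volume_inequality.

Section local_volume_inequality.
Context {R : realType} {n : nat}.
Implicit Types (I J S Y Z : {set 'I_n}).
Variables (B : R) (K : set 'rV[R]_n).
Hypothesis cK : corner_body B K.

(* The integral over [0, 1] of (1 - s^(1/N))^m, for N > 0. *)
Definition beta_coef (N m : nat) : R := m`!%:R * N`!%:R / (m + N)`!%:R.

Lemma volume_inequality_pos J Y Z : [disjoint Y & J]%B -> [disjoint Z & J]%B ->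
  [disjoint Y & Z]%B -> (0 < #|J|)%N ->
  beta_coef #|J| #|Y| * beta_coef #|J| #|Z| *
    (vol (Y :|: Z :|: J)%SET K * vol J K) <=
  beta_coef #|J| (#|Y| + #|Z|) * (vol (Y :|: J)%SET K * vol (Z :|: J)%SET K).
Proof.
move=> dY dZ dYZ N0.
have beta_gt0 m : 0 < beta_coef #|J| m.
  by rewrite /beta_coef divr_gt0 ?mulr_gt0// ltr0n fact_gt0.
(* If P_J K is null the left side is 0; otherwise its volume normalises the fibres. *)
have [v0|v_neq0] := eqVneq (vol J K) 0.
  by rewrite v0 !mulr0 mulr_ge0 ?(ltW (beta_gt0 _))// mulr_ge0// (vol_ge0 cK).
have vJ : 0 < vol J K by rewrite lt_neqAle eq_sym v_neq0 (vol_ge0 cK).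
pose c := (vol J K)^-1; have c0 : 0 < c by rewrite invr_gt0.
have dYZJ : [disjoint (Y :|: Z)%SET & J]%B.
  by rewrite -setI_eq0 finset.setIUl !disjoint_setI0// finset.setU0.
pose lay S s := leb [set y : RT R #|S| | (s%:E <= c%:E * fiber J K (emb y))%E].
pose root (s : R) := s `^ #|J|%:R^-1.
pose D : set (measurableTypeR R) := `]0, 1[%classic.
have DE s : D s -> 0 < s /\ s < 1 by rewrite /D/= in_itv/= => /andP.
have mD : measurable D by exact: measurable_itv.
have bK : borel K by case: cK.
have layE S : [disjoint S & J]%B ->
    ((c * vol (S :|: J)%SET K)%:E = \int[@lebesgue_measure R]_(s in D) lay S s)%E.
  move=> dS; rewrite EFinM (volE cK).
  by apply: (layer_formula dS erefl bK c0) => y; exact: (fiber_le1 cK).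
have lay_fin S s : [disjoint S & J]%B -> D s -> lay S s = (fine (lay S s))%:E.
  move=> dS /DE[s0 _]; rewrite fineK// ge0_fin_numE; last by rewrite /lay -leb_sigma_app.
  exact: (layer_fin cK).
have mlay S : measurable_fun D (lay S) by exact: measurable_layer.
(* Layers at positive levels have finite measure, so they can be replaced by real functions, for
   which monotonicity of quotients is stated by cross-multiplication. *)
pose u S s := fine (lay S s).
have mu S : measurable_fun D (u S).
  by apply: measurableT_comp; [exact: fine_measurable|exact: mlay].
have u0 S s : D s -> 0 <= u S s by move=> _; rewrite /u fine_ge0// /lay -leb_sigma_app.
pose o m s := (1 - root s) ^+ m.
have mo m : measurable_fun D (o m) by exact: measurable_onem_root.
have o0 m s : D s -> 0 <= o m s.
  by move=> /DE[s0 s1]; rewrite exprn_ge0// subr_ge0 ltW// root_lt1// ltW.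
have uE S : [disjoint S & J]%B ->
    (\int[@lebesgue_measure R]_(s in D) (u S s)%:E = (c * vol (S :|: J)%SET K)%:E)%E.
  move=> dS; rewrite layE//; apply: eq_integral => s /[!inE] Ds.
  by rewrite /u -lay_fin.
have oE S : [disjoint S & J]%B ->
    (\int[@lebesgue_measure R]_(s in D) (o #|S| s)%:E = (beta_coef #|J| #|S|)%:E)%E.
  move=> dS; have := beta_layer (R := R) dS N0.
  have S0 : (0 : R) < (#|S|)`!%:R by rewrite ltr0n fact_gt0.
  have mE : measurable_fun D (EFin \o o #|S|) by exact/measurable_EFinP.
  move=> /(congr1 (fun x => (#|S|)`!%:R%:E * x)%E); rewrite -EFinM mulrA.
  rewrite -[in X in X -> _]ge0_integralZl_EFin ?(ltW S0)//; last 2 first.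
  - move=> s Ds; have := o0 #|S| s Ds; rewrite /o lee_fin => H.
    by rewrite mulr_ge0// invr_ge0 ltW.
  - apply/measurable_EFinP; by apply: measurable_funM; [exact: mo|exact: measurable_cst].
  rewrite /beta_coef => <-; apply: eq_integral => s _.
  by rewrite -EFinM mulrCA divff ?gt_eqF// mulr1.
have u_le S s t : [disjoint S & J]%B -> D s -> D t -> s <= t -> u S t <= u S s.
  by move=> dS Ds Dt st; rewrite -lee_fin /u -!lay_fin//; exact: (layer_le cK).
have u_grow S s t : [disjoint S & J]%B -> D s -> D t -> s < t ->
    u S s * o #|S| t <= u S t * o #|S| s.
  move=> dS Ds Dt st; rewrite -lee_fin ![u _ _ * _]mulrC !EFinM /u -!lay_fin//.
  have [s0 _] := DE _ Ds; have [_ t1] := DE _ Dt.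
  exact: (layer_growth cK).
have o_le m s t : D s -> D t -> s <= t -> o m t <= o m s.
  move=> /DE[s0 s1] /DE[t0 t1]; rewrite le_eqVlt => /predU1P[->//|st].
  rewrite /o; apply: lerXn2r; rewrite ?nnegrE ?subr_ge0 ?(ltW (root_lt1 _ _ _)) ?(ltW s0) ?(ltW t0)//.
  by rewrite lerD2l lerN2 ltW// ltr_root// ltW.
(* u / o grows and w decreases, so the product has the required sign for either order of s and t. *)
have cheb S w : [disjoint S & J]%B -> (forall s t, D s -> D t -> s <= t -> w t <= w s) ->
    forall s t, D s -> D t -> (u S s * o #|S| t - u S t * o #|S| s) * (w s - w t) <= 0.
  move=> dS wle s t Ds Dt; have [st|ts|->] := ltgtP s t; last by rewrite !subrr mulr0.
    by rewrite mulr_le0_ge0 ?subr_le0 ?subr_ge0//; [exact: u_grow|exact/wle/ltW].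
  by rewrite mulr_ge0_le0 ?subr_le0 ?subr_ge0//; [exact: u_grow|exact/wle/ltW].
(* First w is the layer function of Z. The second application treats the layers of Z themselves,
   with w the power [o #|Y|], after which both layer functions are separated. *)
have cheb1 := chebyshev_integral (@lebesgue_measure R) mD (mu Y) (mu Z) (mo #|Y|)
  (u0 Y) (u0 Z) (o0 _) (cheb Y _ dY (fun s t => u_le Z s t dZ)).
have cheb2 := chebyshev_integral (@lebesgue_measure R) mD (mu Z) (mo #|Y|) (mo #|Z|)
  (u0 Z) (o0 _) (o0 _) (cheb Z _ dZ (o_le #|Y|)).
(* The two powers multiply to the weight belonging to Y + Z; hence the sum of dimensions in the
   third coefficient. *)
have oYZ : (\int[@lebesgue_measure R]_(s in D) (o #|Z| s * o #|Y| s)%:E =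
    (beta_coef #|J| (#|Y| + #|Z|))%:E)%E.
  have := oE _ dYZJ; rewrite cardsU disjoint_setI0// cards0 subn0 => <-.
  by apply: eq_integral => s _; rewrite /o -exprD addnC.
have main : ((c * vol (Y :|: Z :|: J)%SET K)%:E <=
    \int[@lebesgue_measure R]_(s in D) (u Y s * u Z s)%:E)%E.
  rewrite layE//; apply: ge0_le_integral => //.
  - by move=> s _; rewrite /lay -leb_sigma_app.
  - by apply/measurable_EFinP; exact: measurable_funM.
  - move=> s Ds; rewrite EFinM /u -!lay_fin//.
    by have [s0 _] := DE _ Ds; exact: (layer_product cK).
have swap : (\int[@lebesgue_measure R]_(s in D) (u Z s * o #|Y| s)%:E =
    \int[@lebesgue_measure R]_(s in D) (o #|Y| s * u Z s)%:E)%E.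
  by apply: eq_integral => s _; rewrite mulrC.
rewrite !oE// !uE// in cheb1; rewrite !oE// !uE// oYZ swap in cheb2.
have b1 := beta_gt0 #|Y|; have b2 := beta_gt0 #|Z|.
move: main cheb1 cheb2; move: (beta_coef _ #|Y|) b1 (beta_coef _ #|Z|) b2 => b1 b1_gt0 b2 b2_gt0.
move: (beta_coef _ _) => b3.
set P := (\int[_]_(_ in _) _)%E; set Q := (\int[_]_(_ in _) (o _ _ * _)%:E)%E => main cheb1 cheb2.
have vY := vol_ge0 cK (Y :|: J)%SET.
have step : ((b1 * b2 * (c * vol (Y :|: Z :|: J)%SET K))%:E <=
    (c * vol (Y :|: J)%SET K * (c * vol (Z :|: J)%SET K * b3))%:E)%E.
  apply: (@le_trans _ _ (b2%:E * (b1%:E * P))%E).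
    rewrite muleA -EFinM [b2 * b1]mulrC EFinM; apply: lee_wpmul2l => //.
    by rewrite lee_fin mulr_ge0 ?ltW.
  apply: (@le_trans _ _ (b2%:E * ((c * vol (Y :|: J)%SET K)%:E * Q))%E).
    by apply: lee_wpmul2l => //; rewrite lee_fin ltW.
  rewrite muleCA [leRHS]EFinM; apply: lee_wpmul2l => //.
  by rewrite lee_fin mulr_ge0// ltW.
move: step; rewrite lee_fin.
(* The left side carries c once and the right side twice; the surplus c moves to the left as the
   factor [vol J K]. *)
have -> : b1 * b2 * (c * vol (Y :|: Z :|: J)%SET K) = c * (b1 * b2 * vol (Y :|: Z :|: J)%SET K) by ring.
have -> : c * vol (Y :|: J)%SET K * (c * vol (Z :|: J)%SET K * b3) =
  c * (c * (b3 * (vol (Y :|: J)%SET K * vol (Z :|: J)%SET K))) by ring.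
rewrite ler_pM2l// /c ler_pdivlMl// => H; apply: le_trans H.
by rewrite le_eqVlt; apply/orP; left; apply/eqP; ring.
Qed.

End local_volume_inequality.

(** * Volume of the difference body *)

Section measure_facts.
Context {R : realType}.

Lemma measure_finpart d (T : measurableType d) (mu : {measure set T -> \bar R})
    (J : finType) (F : J -> set T) :
  (forall i, measurable (F i)) -> trivIset setT F ->
  (mu (\bigcup_i F i) = \sum_i mu (F i))%E.
Proof.
move=> mF tF; rewrite (_ : \bigcup_i F i = \bigcup_(i in [set` enum J]) F i); last first.
  by congr bigcup; apply/seteqP; split => i //= _; rewrite mem_enum.
rewrite measure_fin_bigcup//; last exact: sub_trivIset tF.
by rewrite -fsbig_seq ?enum_uniq// big_enum.
Qed.

(** The points lost lie on the coordinate hyperplanes [H k], which are null and are removed one at a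
    time. *)
Lemma leb_positive_part m (X : set (RT R m)) : measurable X ->
  (forall t, X t -> forall k, 0 <= (tnth t k : R)) ->
  leb [set t | (forall k, 0 < (tnth t k : R)) /\ X t] = leb X.
Proof.
move=> mX X0.
pose H (k : 'I_m) : set (RT R m) := tbox (fun j => if j == k then [set 0] else setT).
have mH k : measurable (H k).
  by apply: measurable_tbox => j; case: ifP => // _; exact: measurable_set1.
have H0 k : leb_sigma m (H k) = 0%E.
  rewrite leb_sigma_app leb_box; last by move=> j; case: ifP => // _; exact: measurable_set1.
  by rewrite (bigD1 k)//= eqxx lebesgue_measure_set1 mul0e.
pose P (s : seq 'I_m) := [set t | (forall k, k \in s -> 0 < (tnth t k : R)) /\ X t].
have PS k s : P (k :: s) = P s `\` H k.
  apply/seteqP; split => t /=.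
    move=> [t0 Xt]; split; first by split => // j js; apply: t0; rewrite inE js orbT.
    move=> /(_ k); rewrite eqxx/= => tk; have := t0 k (mem_head _ _).
    by rewrite tk ltxx.
  move=> [[t0 Xt] Ht]; split => // j; rewrite inE => /predU1P[->|]; last exact: t0.
  rewrite lt_neqAle X0// andbT; apply/eqP => tk; apply: Ht => i.
  by case: eqP => [->|].
have Ps s : measurable (P s) /\ leb_sigma m (P s) = leb X.
  elim: s => [|k s [mPs IH]].
    rewrite (_ : P [::] = X) ?leb_sigma_app//.
    by apply/seteqP; split => t /=; [case|split].
  rewrite PS; split; first by apply: measurableD; [exact: mPs|exact: mH].
  have := @measureDI _ _ _ (leb_sigma m) _ _ mPs (mH k).
  rewrite [X in (_ + X)%E](_ : _ = 0%E) ?adde0; first by move=> e; rewrite -IH; exact/esym/e.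
  apply/eqP; rewrite eq_le measure_ge0 andbT -[leRHS](H0 k).
  by apply: le_measure; rewrite ?inE//; exact: measurableI.
have [_ <-] := Ps (enum 'I_m); rewrite -leb_sigma_app; congr (leb_sigma m _).
by apply/seteqP; split => t /= [t0 Xt]; split => // k *; apply: t0; rewrite mem_enum.
Qed.

End measure_facts.

Section difference_volume.
Context {R : realType} {n : nat}.
Implicit Types (I L : {set 'I_n}) (v : 'rV[R]_n).

Definition vpos v : 'rV[R]_n := \row_j Num.max 0 (v 0 j).
Definition vneg v : 'rV[R]_n := \row_j Num.max 0 (- v 0 j).

Variables (bA bB : R) (A B : set 'rV[R]_n).
Hypotheses (cA : corner_body bA A) (cB : corner_body bB B).

(** If v = a - b with a and b nonnegative, then the positive part of v is at most a and its negative
    part at most b, coordinatewise; down-closedness concludes. Conversely v is the difference of its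
    two parts. *)
Lemma mdiffE v : mdiff A B v <-> A (vpos v) /\ B (vneg v).
Proof.
have [_ A0 dA _ _] := cA; have [_ B0 dB _ _] := cB.
split.
  move=> [a Aa [b Bb <-]]; split.
    apply: (dA _ _ Aa) => k; rewrite !mxE le_max lexx/= ge_max.
    have /andP[a0 _] := A0 _ Aa k; have /andP[b0 _] := B0 _ Bb k.
    by rewrite a0 gerBl.
  apply: (dB _ _ Bb) => k; rewrite !mxE le_max lexx/= ge_max.
  have /andP[a0 _] := A0 _ Aa k; have /andP[b0 _] := B0 _ Bb k.
  by rewrite b0 opprB gerBl.
move=> [Av Bv]; exists (vpos v) => //; exists (vneg v) => //.
apply/rowP => k; rewrite !mxE.
by case: (leP 0 (v 0 k)) => H; case: (leP 0 (- v 0 k)) => H' //; lra.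
Qed.

(** Strict inequality on L and weak inequality off L make the pieces pairwise disjoint, with union A
    - B. *)
Definition sign_piece L : set 'rV[R]_n :=
  [set v : 'rV[R]_n | [/\ forall j, j \in L -> 0 < v 0 j, forall j, j \notin L -> v 0 j <= 0,
     A (vpos v) & B (vneg v)]].

Lemma borel_sign_piece L : borel (sign_piece L).
Proof.
have [mA _ _ _ _] := cA; have [mB _ _ _ _] := cB.
have mt (k : 'I_n) : measurable_fun setT (fun t : RT R n => tnth t k) by exact: measurable_tnth.
rewrite /borel (_ : mkset _ =
  tbox (fun j => if j \in L then `]0, +oo[%classic else `]-oo, 0]%classic) `&`
  ([set t : RT R n | A (vpos (\row_k tnth t k))] `&`
   [set t : RT R n | B (vneg (\row_k tnth t k))])); last first.
  apply/seteqP; split => t /=.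
    move=> [H1 H2 At Bt]; split => // k; case: ifPn => kL.
      by have := H1 k kL; rewrite /= mxE in_itv/= andbT.
    by have := H2 k kL; rewrite /= mxE in_itv/=.
  move=> [H [At Bt]]; split => // j jL; have := H j.
    by rewrite jL /= in_itv/= andbT mxE.
  by rewrite (negbTE jL) /= in_itv/= mxE.
apply: measurableI; first by apply: measurable_tbox => k; case: ifP => _; exact: measurable_itv.
apply: measurableI.
  apply: (borel_preimage _ mA) => k.
  rewrite (_ : (fun t => _) = (fun t : RT R n => Num.max 0 (tnth t k : R))); last first.
    by apply/funext => t; rewrite !mxE.
  by apply: measurable_maxr; [exact: measurable_cst|exact: mt].
apply: (borel_preimage _ mB) => k.
rewrite (_ : (fun t => _) = (fun t : RT R n => Num.max 0 (- (tnth t k : R)))); last first.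
  by apply/funext => t; rewrite !mxE.
by apply: measurable_maxr; [exact: measurable_cst|exact: measurableT_comp].
Qed.

(** In the coordinates L and I \ L the piece is a product: the section of A without its points on
    coordinate hyperplanes, times the reflected section of B. *)
Lemma leb_sign_piece I L : L \subset I ->
  leb [set t : RT R #|I| | sign_piece L (emb t)] = (vol L A * vol (I :\: L)%SET B)%:E.
Proof.
move=> LI.
have dL : [disjoint L & (I :\: L)%SET]%B.
  by rewrite -setI_eq0 finset.setIDA finset.setIC finset.setDIl finset.setDv finset.setI0.
have UL : (L :|: (I :\: L))%SET = I.
  by apply/setP => j; rewrite !inE; case: (boolP (j \in L)) => //= /(fintype.subsetP LI).
rewrite (leb_split dL UL (borel_sign_piece L)).
have [_ A0 _ _ _] := cA; have [_ B0 _ _ _] := cB.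
have [mLA _ _] := section_down_closed cA L.
have [mLB _ _] := section_down_closed cB (I :\: L)%SET.
pose P := [set x : RT R #|L| | (forall k, 0 < (tnth x k : R)) /\ A (emb x)].
pose Q := [set y : RT R #|(I :\: L)%SET| | B (emb (tscale (-1) y))].
have mP : measurable P.
  rewrite (_ : P = tbox (fun=> `]0, +oo[%classic) `&` [set x | A (emb x)]).
    by apply: measurableI => //; apply: measurable_tbox.
  apply/seteqP; split => x /= [x0 Ax]; split => // k; have := x0 k;
    by rewrite /= in_itv/= andbT.
have mQ : measurable Q.
  rewrite -[X in measurable X]setTI.
  exact: (@measurable_tscale _ _ (-1) measurableT _ mLB).
have -> : [set p : RT R #|L| * RT R #|(I :\: L)%SET| | sign_piece L (emb p.1 + emb p.2)] = P `*` Q.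
  have vposE (x : RT R #|L|) (y : RT R #|(I :\: L)%SET|) :
      (forall k, 0 < (tnth x k : R)) -> (forall k, (tnth y k : R) <= 0) ->
      vpos (emb x + emb y) = emb x /\ vneg (emb x + emb y) = emb (tscale (-1) y).
    move=> x0 y0; have /emb_ge0 xe : forall k, 0 <= (tnth x k : R) by move=> k; exact/ltW.
    have ye j : emb y 0 j <= 0.
      have [jI|jI] := boolP (j \in (I :\: L)%SET); last by rewrite emb_notin.
      by rewrite -(enum_rankK_in jI jI) emb_enum_val.
    have xy j : emb x 0 j = 0 \/ emb y 0 j = 0.
      have [jL|jL] := boolP (j \in L); last by left; rewrite emb_notin.
      by right; rewrite emb_notin// inE jL.
    split; apply/rowP => j; rewrite ?emb_scale !mxE; have := xe j; have := ye j.
      case: (xy j) => ->; first by rewrite add0r => /max_idPl.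
      by rewrite addr0 => _ /max_idPr.
    rewrite mulN1r; case: (xy j) => ->.
      by rewrite add0r => y'; rewrite (max_idPr _)// oppr_ge0.
    by rewrite addr0 oppr0 => _ x'; rewrite (max_idPl _)// oppr_le0.
  apply/seteqP; split => -[x y] /=.
    move=> [H1 H2 Av Bv].
    have x0 k : 0 < (tnth x k : R).
      have := H1 _ (enum_valP k).
      by rewrite mxE emb_enum_val (@emb_notin _ _ (I :\: L)%SET) ?addr0// inE enum_valP.
    have y0 k : (tnth y k : R) <= 0.
      have := enum_valP k; rewrite inE => /andP[kL kI].
      by have := H2 _ kL; rewrite mxE emb_enum_val (@emb_notin _ _ L) ?add0r.
    by have [vp vn] := vposE x y x0 y0; rewrite vp in Av; rewrite vn in Bv.
  move=> [[x0 Ax] By].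
  have y0 k : (tnth y k : R) <= 0.
    have := B0 _ By (enum_val k); rewrite emb_enum_val tnth_mktuple mulN1r oppr_ge0.
    by case/andP.
  have [vp vn] := vposE x y x0 y0.
  split; rewrite ?vp ?vn//.
    move=> j jL; rewrite mxE (@emb_notin _ _ (I :\: L)%SET) ?inE ?jL// addr0.
    by rewrite -(enum_rankK_in jL jL) emb_enum_val.
  move=> j jL; rewrite mxE (@emb_notin _ _ L)// add0r.
  have [jI|jI] := boolP (j \in (I :\: L)%SET); last by rewrite emb_notin.
  by rewrite -(enum_rankK_in jI jI) emb_enum_val.
rewrite product_measure1E// EFinM (volE cA) (volE cB); congr (_ * _)%E.
  rewrite [LHS]leb_sigma_app leb_positive_part// => t /A0 H k.
  by have := H (enum_val k); rewrite emb_enum_val => /andP[].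
rewrite [LHS]leb_sigma_app [RHS](leb_scale (c := -1))// ?oppr_eq0 ?oner_eq0//.
by rewrite normrN1 expr1n mul1e.
Qed.

Lemma leb_mdiff I : leb [set t : RT R #|I| | mdiff A B (emb t)] =
  (\sum_(L : {set 'I_n} | L \subset I) vol L A * vol (I :\: L)%SET B)%:E.
Proof.
rewrite (_ : mkset _ = \bigcup_L [set t : RT R #|I| | sign_piece L (emb t)]); last first.
  apply/seteqP; split => t /=.
    move=> /mdiffE[At Bt]; exists [set j | 0 < emb t 0 j]%SET => //.
    split => // j; rewrite inE// -leNgt//.
  by move=> [L _ [_ _ At Bt]]; apply/mdiffE.
rewrite -leb_sigma_app measure_finpart.
(* If L is not included in I the piece misses R^I, where the coordinates off I vanish. *)
- rewrite (bigID (fun L : {set 'I_n} => L \subset I))/= [X in (_ + X)%E]big1 ?adde0.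
    rewrite -sumEFin; apply: eq_bigr => L LI.
    by rewrite leb_sigma_app leb_sign_piece.
  move=> L /fintype.subsetPn[j jL jI]; rewrite (_ : mkset _ = set0) ?measure0// -subset0.
  by move=> t [/(_ _ jL)]; rewrite emb_notin// ltxx.
- by move=> L; apply: borel_emb; exact: borel_sign_piece.
- move=> L L' _ _ [t [[H1 H2 _ _] [H1' H2' _ _]]]; apply/setP => j.
  apply/idP/idP => jL.
    apply/negPn/negP => /H2'; rewrite leNgt; exact/negP/negPn/H1.
  apply/negPn/negP => /H2; rewrite leNgt; exact/negP/negPn/H1'.
Qed.

Lemma vol_mdiff I : vol I (mdiff A B) =
  \sum_(L : {set 'I_n} | L \subset I) vol L A * vol (I :\: L)%SET B.
Proof. by rewrite /vol leb_mdiff. Qed.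

End difference_volume.

Lemma beta_coefE {R : realType} N m : beta_coef N m = ('C(m + N, N)%:R)^-1 :> R.
Proof.
have f0 k : (k`!%:R : R) != 0 by rewrite pnatr_eq0 -lt0n fact_gt0.
have b0 : ('C(m + N, N)%:R : R) != 0 by rewrite pnatr_eq0 -lt0n bin_gt0 leq_addl.
rewrite /beta_coef -(bin_fact (leq_addl m N)) addnK !natrM.
by field; rewrite b0 !f0.
Qed.

Section volume_inequality_dconst.
Context {R : realType} {n : nat}.
Implicit Types (I J : {set 'I_n}).
Variables (B : R) (K : set 'rV[R]_n).
Hypothesis cK : corner_body B K.

Lemma vol_set0 : vol finset.set0 K = 1.
Proof.
have [_ _ _ _ K0] := cK.
rewrite /vol leb_dim0 ?cards0//; exists [tuple (0 : R) | k < #|finset.set0 : {set 'I_n}|].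
by rewrite /= -/(emb _) emb0.
Qed.

(** This settles the case of empty J, where there is no fibre direction and the constant is 1: K is
    included in the product of its two sections. *)
Lemma vol_le_product I : vol [set: 'I_n]%SET K <= vol I K * vol (~: I)%SET K.
Proof.
have [bK K_bound K_down _ K0] := cK.
have dI : [disjoint I & (~: I)%SET]%B by rewrite -setI_eq0 finset.setICr.
rewrite -lee_fin EFinM !(volE cK) (leb_split dI (finset.setUCr I) bK).
have [mI _ _] := section_down_closed cK I.
have [mIC _ _] := section_down_closed cK (~: I)%SET.
rewrite -!leb_sigma_app -product_measure1E//; apply: le_measure; rewrite ?inE.
- exact: borel_emb2.
- exact: measurableX.
move=> -[x y] /= Kxy.
have dI' : [disjoint (~: I)%SET & I]%B by rewrite disjoint_sym.
have [] := @emb_add_ge0 _ _ _ _ y x dI' (fun j => proj1 (andP (K_bound _ Kxy j))).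
move=> /emb_ge0 x0 /emb_ge0 y0.
by split; apply: (K_down _ _ Kxy) => j; rewrite mxE ?x0 ?y0 ?lerDl ?lerDr ?x0 ?y0.
Qed.

(** The index j is the dimension of J + ~I, so that i + j - n is the dimension N of J. As the beta
    coefficients are inverse binomials, their quotient is [dconst]. *)
Lemma volume_inequality I J : J \subset I ->
  vol [set: 'I_n]%SET K * vol J K <=
  dconst R n #|I| (#|J| + (n - #|I|)) * (vol I K * vol (J :|: ~: I)%SET K).
Proof.
move=> JI; have In : (#|I| <= n)%N by rewrite -[X in (_ <= X)%N]card_ord max_card.
have Nn : (#|J| <= #|I|)%N by exact: subset_leq_card.
have NE : (#|I| + (#|J| + (n - #|I|)) - n = #|J|)%N by lia.
rewrite /dconst NE; have [N0|N_gt0] := posnP #|J|.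
  rewrite N0 !bin0 mul1n divr1 mul1r.
  have -> : J = finset.set0 by apply/eqP; rewrite -cards_eq0 N0.
  by rewrite vol_set0 mulr1 finset.set0U vol_le_product.
pose Y := (I :\: J)%SET; pose Z := (~: I)%SET.
have dY : [disjoint Y & J]%B by rewrite -setI_eq0 finset.setIDAC finset.setDIl finset.setDv finset.setI0.
have dZ : [disjoint Z & J]%B by rewrite disjoint_sym finset.disjoints_subset finset.setCK.
have dYZ : [disjoint Y & Z]%B by rewrite finset.disjoints_subset finset.setCK finset.subsetDl.
have YJ : (Y :|: J)%SET = I.
  by apply/setP => j; rewrite !inE; case: (boolP (j \in J)) => [/(fintype.subsetP JI) ->|]; rewrite ?orbT ?orbF.
have ZJ : (Z :|: J)%SET = (J :|: ~: I)%SET by rewrite finset.setUC.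
have YZJ : (Y :|: Z :|: J)%SET = [set: 'I_n]%SET.
  by rewrite -finset.setUA [(Z :|: J)%SET]finset.setUC finset.setUA YJ finset.setUCr.
have cY : #|Y| = (#|I| - #|J|)%N by rewrite cardsDS.
have cZ : #|Z| = (n - #|I|)%N by rewrite cardsCs finset.setCK card_ord.
have := volume_inequality_pos cK dY dZ dYZ N_gt0.
rewrite YZJ YJ ZJ cY cZ !beta_coefE subnK// [(n - _ + _)%N]addnC.
rewrite (_ : (#|I| - #|J| + (n - #|I|) + #|J|)%N = n); last by lia.
have C0 m k : (k <= m)%N -> (0 : R) < 'C(m, k)%:R by move=> km; rewrite ltr0n bin_gt0.
have c1 := C0 _ _ Nn; have c2 := C0 _ _ (leq_addr (n - #|I|) #|J|).
have c3 := C0 _ _ (leq_trans Nn In).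
rewrite -invfM ler_pdivrMl ?mulr_gt0// => H; apply: le_trans H _.
by rewrite natrM; lra.
Qed.

End volume_inequality_dconst.

(** * Anti-blocking bodies as down-closed convex bodies *)

Section anti_blocking_bodies.
Context {R : realType} {n : nat}.
Implicit Types (I : {set 'I_n}) (K : set 'rV[R]_n).

Lemma coord_projE I (x : 'rV[R]_n) j : coord_proj I x 0 j = if j \in I then x 0 j else 0.
Proof.
rewrite /coord_proj summxE; case: ifPn => jI.
  rewrite (bigD1 j)//= !mxE !eqxx mulr1 big1 ?addr0// => k /andP[_ kj].
  by rewrite !mxE eqxx/= eq_sym (negbTE kj) mulr0.
rewrite big1// => k kI; rewrite !mxE eqxx/=; case: eqP => [jk|]; last by rewrite mulr0.
by rewrite jk kI in jI.
Qed.

Lemma coord_subspaceE I (x : 'rV[R]_n) :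
  coord_subspace I x <-> (forall j, j \notin I -> x 0 j = 0).
Proof.
split=> [[a ->] j jI|H].
  rewrite summxE big1// => k kI; rewrite !mxE eqxx/=.
  by case: eqP => [jk|]; rewrite ?mulr0//; rewrite jk kI in jI.
exists (fun k => x 0 k); apply/rowP => j; rewrite -/(coord_proj I x) coord_projE.
by case: ifPn => // /H.
Qed.

(** The main point is down-closedness: projections set coordinates to 0 and convexity reaches the
    values in between, one coordinate at a time. *)
Lemma anti_blocking_corner K : anti_blocking K -> exists B, corner_body B K.
Proof.
move=> [[cvK cK [x0 Kx0]] K_ge0 Kproj].
have Kp I x : K x -> K (coord_proj I x).
  by move=> Kx; have [] : (K `&` coord_subspace I) (coord_proj I x) by rewrite -Kproj; exists x.
have K_conv x y t : K x -> K y -> 0 <= t <= 1 -> K (t *: x + (1 - t) *: y).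
  move=> Kx Ky /andP[t0 t1].
  have := cvK x y (Itv01 t0 t1); rewrite !inE; apply; exact.
(* Convex combination of x and its projection along e_k, with weight c / x_k on x. *)
have K_set x k (c : R) : K x -> 0 <= c <= x 0 k ->
    K (\row_j (if j == k then c else x 0 j)).
  move=> Kx /andP[c0 cx]; have [xk|xk] := eqVneq (x 0 k) 0.
    rewrite (_ : \row_j _ = x)//; apply/rowP => j; rewrite mxE; case: eqP => // ->.
    by apply/eqP; rewrite eq_le cx xk.
  have xk0 : 0 < x 0 k by rewrite lt_neqAle eq_sym xk (le_trans c0).
  have t01 : 0 <= c / x 0 k <= 1.
    by rewrite divr_ge0 ?(ltW xk0)//= ler_pdivrMr// mul1r.
  have := K_conv _ _ _ Kx (Kp [set~ k]%SET _ Kx) t01; congr K.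
  apply/rowP => j; rewrite !mxE coord_projE !inE; case: eqP => [->|_] /=.
    by rewrite mulr0 addr0 divfK.
  ring.
have K_down x (y : 'rV[R]_n) : K x -> (forall k, 0 <= y 0 k <= x 0 k) -> K y.
  move=> Kx xy.
  suff H (s : seq 'I_n) : K (\row_j (if j \in s then y 0 j else x 0 j)).
    have := H (enum 'I_n); congr K; apply/rowP => j; by rewrite mxE mem_enum.
  elim: s => [|k s IH].
    by move: Kx; congr K; apply/rowP => j; rewrite mxE.
  have := K_set _ k (y 0 k) IH; rewrite mxE.
  have -> : 0 <= y 0 k <= (if k \in s then y 0 k else x 0 k).
    by have /andP[y0 yx] := xy k; case: ifP; rewrite y0 ?lexx.
  move=> /(_ isT); congr K; apply/rowP => j; rewrite !mxE inE.
  by case: eqP => [->|].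
have [M [Mr KM]] := compact_bounded cK.
(* Boundedness holds for every number strictly above M, hence the 1. *)
exists (M + 1); split => //.
- by apply: closed_borel; apply: compact_closed cK; exact: norm_hausdorff.
- move=> x Kx k; rewrite K_ge0//=.
  apply: le_trans (ler_norm _) _; apply: le_trans (KM (M + 1) _ x Kx); last by rewrite ltrDl.
  by rewrite [leRHS]/Num.norm/= mx_normrE; apply/bigmax_geP; right; exists (0, k).
- apply: (K_down _ _ Kx0) => k; rewrite mxE lexx/=; exact: K_ge0.
Qed.

Lemma anti_blocking_intro B K : corner_body B K -> closed K -> anti_blocking K.
Proof.
move=> [_ K_bound K_down K_conv K0] clK; split.
- split; last by exists 0.
    move=> x y l; rewrite !inE => Kx Ky.
    by apply: (K_conv x y l%:num) => //; rewrite ge0 le1.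
  apply: bounded_closed_compact => //; exists (Num.max 0 B); split; first exact: num_real.
  move=> M; rewrite gt_max => /andP[M0 BM] x Kx.
  rewrite /= [leLHS]/Num.norm/= mx_normrE; apply: bigmax_le; first exact: ltW.
  move=> [i k] _ /=; rewrite (ord1 i); have /andP[x0 xB] := K_bound _ Kx k.
  by rewrite ger0_norm// (le_trans xB)// ltW.
- by move=> x /K_bound xB k; have /andP[] := xB k.
- move=> I; apply/seteqP; split => y.
    move=> [x Kx <-]; split.
      apply: (K_down _ _ Kx) => k; rewrite coord_projE.
      have /andP[x0 _] := K_bound _ Kx k.
      by case: ifP; rewrite ?lexx x0.
    by apply/coord_subspaceE => j jI; rewrite coord_projE (negbTE jI).
  move=> [Ky /coord_subspaceE yI]; exists y => //; apply/rowP => j.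
  by rewrite coord_projE; case: ifPn => // /yI.
Qed.

(** A set stable under the projection meets the subspace exactly in its image. *)
Lemma vol_coord_proj I K : (forall x, K x -> K (coord_proj I x)) ->
  vol I (coord_proj I @` K) = vol I K.
Proof.
move=> Kp; rewrite /vol; congr (fine (leb _)); apply/seteqP; split => t /=.
  by move=> [x Kx <-]; exact: Kp.
move=> Kt; eexists; first exact: Kt.
apply/rowP => j; rewrite coord_projE; case: ifPn => // jI.
by rewrite -/(emb t) emb_notin.
Qed.

End anti_blocking_bodies.

(** * Upper bound *)

Section upper_bound.
Context {R : realType} {n : nat}.
Implicit Types (I J L : {set 'I_n}) (A B : set 'rV[R]_n).

Lemma dconst_le_rconst i j : (j <= n)%N -> (n <= i + j)%N -> dconst R n i j <= rconst R n i.
Proof.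
rewrite -ltnS => jn nij.
exact: (@le_bigmax_cond _ _ _ 0 (Ordinal jn) (fun j : 'I_n.+1 => n <= i + j)%N
  (fun j : 'I_n.+1 => dconst R n i j)).
Qed.

Lemma corner_coord_proj b A I x : corner_body b A -> A x -> A (coord_proj I x).
Proof.
move=> [_ A_bound A_down _ _] Ax; apply: (A_down _ _ Ax) => k; rewrite coord_projE.
by have /andP[x0 _] := A_bound _ Ax k; case: ifP; rewrite ?lexx x0.
Qed.

Lemma vol_coord_proj_mdiff a b A B I : corner_body a A -> corner_body b B ->
  vol I (coord_proj I @` mdiff A B) = vol I (mdiff A B).
Proof.
move=> cA cB; apply: vol_coord_proj => _ [x Ax [y By <-]].
exists (coord_proj I x); first exact: corner_coord_proj cA Ax.
exists (coord_proj I y); first exact: corner_coord_proj cB By.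
by apply/rowP => j; rewrite !mxE !coord_projE !mxE; case: ifP; rewrite ?subr0.
Qed.

(* The sets L included in I and those containing ~: I form disjoint families,
   since ~: I is nonempty. *)
Lemma sum_two_families (f : {set 'I_n} -> {set 'I_n} -> R) I : I \proper [set: 'I_n]%SET ->
  (forall L L', 0 <= f L L') ->
  \sum_(L : {set 'I_n} | L \subset I) f (L :|: ~: I)%SET (I :\: L)%SET +
  \sum_(L : {set 'I_n} | L \subset I) f L (I :\: L :|: ~: I)%SET <=
  \sum_(L : {set 'I_n} | L \subset [set: 'I_n]%SET) f L ([set: 'I_n] :\: L)%SET.
Proof.
move=> IT f0.
rewrite [leRHS](bigID (fun L : {set 'I_n} => L \subset I))/= [leLHS]addrC lerD//.
  rewrite le_eqVlt; apply/orP; left; apply/eqP.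
  apply: eq_big => [L|L LI]; first by rewrite finset.subsetT.
  congr (f _ _); apply/setP => j; rewrite !inE andbT.
  by case: (boolP (j \in I)) => jI; rewrite ?andbT ?orbF ?orbT//;
    case: (boolP (j \in L)) => // /(fintype.subsetP LI); rewrite (negbTE jI).
(* Of the L not included in I only those containing ~: I are kept. They are L' :|: ~: I for a unique
   L' included in I, and properness of I ensures that such a union is never included in I. *)
rewrite [leRHS](bigID (fun L : {set 'I_n} => ~: I \subset L)%SET)/=.
rewrite -[leLHS]addr0 lerD ?sumr_ge0// le_eqVlt; apply/orP; left; apply/eqP.
rewrite [RHS](reindex_onto (fun L => L :|: ~: I)%SET (fun L => L :&: I)%SET)/=; last first.
  move=> L /andP[_ IL]; apply/setP => j; rewrite !inE; have := fintype.subsetP IL j.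
  by rewrite inE; case: (j \in I) => /=; case: (j \in L) => //= /(_ isT).
apply: eq_big => [L|L LI].
  rewrite finset.subsetT/= finset.subsetUr andbT.
  have -> : ((L :|: ~: I) :&: I)%SET = (L :&: I)%SET.
    by rewrite finset.setIUl [(~: I :&: I)%SET]finset.setIC finset.setICr finset.setU0.
  have -> : (L :|: ~: I \subset I)%SET = false.
    apply/negbTE/negP => H; have [_ [j _ jI]] := properP IT.
    by have := fintype.subsetP H j; rewrite !inE jI orbT (negbTE jI) => /(_ isT).
  by rewrite /=; apply/idP/eqP => /finset.setIidPl.
congr (f _ _); apply/setP => j; rewrite !inE andbT negb_or negbK.
by rewrite andbC.
Qed.

(** In the expansion of |P_E (A - B)| the term |P_L A| |P_(I \ L) B| is combined with |A| through
    the volume inequality for J = L, and with |B| through the one for J = I \ L. This produces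
    exactly the two families of terms of |A - B|. *)
Theorem volume_ratio_upper_bound A B I : I \proper [set: 'I_n]%SET ->
  anti_blocking A -> anti_blocking B ->
  vol [set: 'I_n]%SET A / vol I (coord_proj I @` A)
    + vol [set: 'I_n]%SET B / vol I (coord_proj I @` B)
  <= rconst R n #|I| * (vol [set: 'I_n]%SET (mdiff A B)
                  / vol I (coord_proj I @` mdiff A B)).
Proof.
move=> IT /anti_blocking_corner[a cA] /anti_blocking_corner[b cB].
rewrite (vol_coord_proj_mdiff _ cA cB) !vol_coord_proj; last 2 first.
- by move=> x; exact: corner_coord_proj cB.
- by move=> x; exact: corner_coord_proj cA.
rewrite !(vol_mdiff cA cB).
set S := \sum_(L : {set 'I_n} | L \subset I) _.
have A0 L : 0 <= vol L A := vol_ge0 cA L.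
have B0 L : 0 <= vol L B := vol_ge0 cB L.
have In : (#|I| <= n)%N by rewrite -[X in (_ <= X)%N]card_ord max_card.
have rle L : L \subset I ->
    dconst R n #|I| (#|L| + (n - #|I|)) <= rconst R n #|I|.
  by move=> /subset_leq_card LI; apply: dconst_le_rconst; lia.
have r0 : 0 <= rconst R n #|I|.
  apply: le_trans (rle _ (finset.sub0set I)); rewrite /dconst divr_ge0//.
have ineq C (c : R) L : corner_body c C -> L \subset I ->
    vol [set: 'I_n]%SET C * vol L C <=
    rconst R n #|I| * (vol I C * vol (L :|: ~: I)%SET C).
  move=> cC LI; apply: le_trans (volume_inequality cC LI) _.
  by rewrite ler_wpM2r ?rle// mulr_ge0// (vol_ge0 cC).
have S_ge0 : 0 <= S by rewrite /S sumr_ge0// => L _; rewrite mulr_ge0.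
(* Quotients by 0 are 0. If the projection of A - B is null, the terms L = I and L = 0 show that
   those of A and B are null as well, so both sides vanish. *)
have [S_eq0|S_neq0] := eqVneq S 0.
  have term0 L : L \subset I -> vol L A * vol (I :\: L)%SET B = 0.
    move=> LI; apply/eqP; rewrite eq_le mulr_ge0// andbT -S_eq0 /S (bigD1 L)//=.
    by rewrite lerDl sumr_ge0// => L' _; rewrite mulr_ge0.
  have SA : vol I A = 0.
    by have := term0 I (subxx _); rewrite finset.setDv (vol_set0 cB) mulr1.
  have SB : vol I B = 0.
    by have := term0 _ (finset.sub0set I); rewrite finset.setD0 (vol_set0 cA) mul1r.
  by rewrite S_eq0 SA SB invr0 !mulr0 addr0.
have S_gt0 : 0 < S by rewrite lt_neqAle eq_sym S_neq0.
rewrite mulrA ler_pdivlMr//.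
apply: le_trans (ler_wpM2l r0 (sum_two_families (f := fun L L' => vol L A * vol L' B) IT _)); last first.
  by move=> L L'; rewrite mulr_ge0.
rewrite mulrDr mulrDl lerD//.
- have [->|AI] := eqVneq (vol I A) 0.
    by rewrite invr0 mulr0 mul0r mulr_ge0// sumr_ge0// => L _; rewrite mulr_ge0.
  have AI0 : 0 < vol I A by rewrite lt_neqAle eq_sym AI A0.
  rewrite mulrAC ler_pdivrMr// /S !mulr_sumr mulr_suml ler_sum// => L LI.
  rewrite mulrA [leRHS](_ : _ = rconst R n #|I| * (vol I A * vol (L :|: ~: I)%SET A) * vol (I :\: L)%SET B); last by ring.
  by rewrite ler_wpM2r// (ineq _ _ _ cA).
- have [->|BI] := eqVneq (vol I B) 0.
    by rewrite invr0 mulr0 mul0r mulr_ge0// sumr_ge0// => L _; rewrite mulr_ge0.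
  have BI0 : 0 < vol I B by rewrite lt_neqAle eq_sym BI B0.
  rewrite mulrAC ler_pdivrMr// /S !mulr_sumr mulr_suml ler_sum// => L LI.
  rewrite mulrCA [leRHS](_ : _ = vol L A * (rconst R n #|I| * (vol I B * vol (I :\: L :|: ~: I)%SET B))); last by ring.
  by rewrite ler_wpM2l// (ineq _ _ _ cB)// finset.subsetDl.
Qed.

End upper_bound.

(** * Sharpness *)

Section extremal_bodies.
Context {R : realType} {n : nat}.
Implicit Types (I J L S : {set 'I_n}).

Lemma closed_coord_le (r : R) S : closed [set v : 'rV[R]_n | \sum_(j in S) v 0 j <= r].
Proof.
have cf : continuous (fun v : 'rV[R]_n => \sum_(j in S) v 0 j).
  apply: continuous_big => [|j _]; [exact: add_continuous|exact: coord_continuous].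
exact: (closed_comp (fun x _ => cf x) (@closed_le _ r)).
Qed.

Lemma closed_nonneg : closed [set v : 'rV[R]_n | forall j, 0 <= v 0 j].
Proof.
rewrite (_ : mkset _ = \bigcap_j [set v : 'rV[R]_n | 0 <= v 0 j]); last first.
  by apply/seteqP; split => v H j => [_|]; exact: H.
apply: closed_bigI => j _.
have cf : continuous (fun v : 'rV[R]_n => v 0 j) by exact: coord_continuous.
exact: (closed_comp (fun x _ => cf x) (@closed_ge _ 0)).
Qed.

Definition box (s : 'I_n -> R) : set 'rV[R]_n := [set v | forall j, 0 <= v 0 j <= s j].

Lemma closed_box s : closed (box s).
Proof.
rewrite (_ : box s = [set v : 'rV[R]_n | forall j, 0 <= v 0 j] `&`
  \bigcap_j [set v : 'rV[R]_n | v 0 j <= s j]); last first.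
  apply/seteqP; split => v.
    by move=> H; split => j => [|_] /=; have /andP[] := H j.
  by move=> [H1 H2] j; rewrite H1/=; exact: H2.
apply: closedI; first exact: closed_nonneg.
apply: closed_bigI => j _.
have cf : continuous (fun v : 'rV[R]_n => v 0 j) by exact: coord_continuous.
exact: (closed_comp (fun x _ => cf x) (@closed_le _ (s j))).
Qed.

Lemma corner_body_box s (M : R) : (forall j, 0 <= s j <= M) -> corner_body M (box s).
Proof.
move=> sM; split.
- by apply: closed_borel; exact: closed_box.
- move=> x xs k; have /andP[-> x1] := xs k; have /andP[_ sk] := sM k.
  exact: le_trans sk.
- move=> x y xs yx k; have /andP[-> y1] := yx k; have /andP[_ x1] := xs k.
  exact: le_trans x1.
- move=> x y t xs ys /andP[t0 t1] k; rewrite !mxE.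
  have /andP[x0 x1] := xs k; have /andP[y0 y1] := ys k.
  rewrite addr_ge0 ?mulr_ge0 ?subr_ge0//=.
  apply: (@le_trans _ _ (t * s k + (1 - t) * s k)); last by rewrite -mulrDl subrKC mul1r.
  by rewrite lerD ?ler_wpM2l ?subr_ge0.
- by move=> k; rewrite mxE lexx/=; have /andP[] := sM k.
Qed.

Lemma vol_box s L : (forall j, 0 <= s j) -> vol L (box s) = \prod_(j in L) s j.
Proof.
move=> s0; rewrite /vol.
rewrite (_ : mkset _ = tbox (fun k : 'I_#|L| => `[0, s (enum_val k)]%classic)); last first.
  apply/seteqP; split => t /= H.
    by move=> k /=; rewrite in_itv/=; have := H (enum_val k); rewrite -/(emb t) emb_enum_val.
  rewrite -/(emb t) => j; have [jL|jL] := boolP (j \in L); last by rewrite emb_notin// lexx s0.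
  by have := H (enum_rank_in jL j); rewrite /= in_itv/= -emb_enum_val enum_rankK_in.
rewrite leb_box// (eq_bigr (fun k : 'I_#|L| => (s (enum_val k))%:E)).
  by rewrite prodEFin/= -big_enum_val.
move=> k _; rewrite lebesgue_measure_itv/= lte_fin.
by have := s0 (enum_val k); rewrite le_eqVlt => /predU1P[<-|->]; rewrite ?ltxx ?sube0.
Qed.

Lemma box_interior K (d : R) : 0 < d -> box (fun=> d) `<=` K -> K° !=set0.
Proof.
move=> d0 dK; exists (const_mx (d / 2)); rewrite /interior -nbhs_ballE.
exists (d / 2); first by rewrite /= divr_gt0.
move=> v [_ Hv]; apply: dK => j; have := Hv 0 j.
rewrite mxE /ball/= ltr_distl => /andP[v1 v2]; lra.
Qed.

Variables (I J : {set 'I_n}).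
Hypothesis JI : J \subset I.

Local Notation F := (J :|: ~: I)%SET.
Local Notation Y := (I :\: J)%SET.
Local Notation Z := (~: I)%SET.

(** The constraint with the maximum, split into two linear ones: I is J + Y and F is J + Z. The
    sections by R^I and R^F are therefore standard simplices. *)
Definition extremal : set 'rV[R]_n :=
  [set v | [/\ forall j, 0 <= v 0 j, \sum_(j in I) v 0 j <= 1 & \sum_(j in F) v 0 j <= 1]].

Lemma closed_extremal : closed extremal.
Proof.
rewrite (_ : extremal = [set v : 'rV[R]_n | forall j, 0 <= v 0 j] `&`
  ([set v | \sum_(j in I) v 0 j <= 1] `&` [set v | \sum_(j in F) v 0 j <= 1])); last first.
  by apply/seteqP; split => v => [[]|[? []]].
apply: closedI; first exact: closed_nonneg.
by apply: closedI; exact: closed_coord_le.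
Qed.

Lemma corner_body_extremal : corner_body 1 extremal.
Proof.
split.
- by apply: closed_borel; exact: closed_extremal.
- move=> x [x0 xI xF] k; rewrite x0/=.
  have [kI|kI] := boolP (k \in I).
    by apply: le_trans xI; rewrite (bigD1 k)//= lerDl sumr_ge0.
  apply: le_trans xF; rewrite (bigD1 k)/= ?lerDl ?sumr_ge0//.
  by rewrite !inE kI orbT.
- move=> x y [x0 xI xF] xy; split.
  + by move=> j; have /andP[] := xy j.
  + by apply: le_trans xI; apply: ler_sum => j _; have /andP[] := xy j.
  + by apply: le_trans xF; apply: ler_sum => j _; have /andP[] := xy j.
- move=> x y t [x0 xI xF] [y0 yI yF] /andP[t0 t1].
  have comb S : \sum_(j in S) (t *: x + (1 - t) *: y) 0 j =
      t * \sum_(j in S) x 0 j + (1 - t) * \sum_(j in S) y 0 j.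
    by rewrite !mulr_sumr -big_split/=; apply: eq_bigr => j _; rewrite !mxE.
  have t1' : 0 <= 1 - t by rewrite subr_ge0.
  split; rewrite ?comb.
  + by move=> j; rewrite !mxE addr_ge0// mulr_ge0.
  + by rewrite -[leRHS](subrKC t) lerD// ler_piMr.
  + by rewrite -[leRHS](subrKC t) lerD// ler_piMr.
- by split; [move=> j; rewrite mxE|rewrite big1// => j _; rewrite mxE..].
Qed.

Lemma sum_emb_in L S (t : RT R #|L|) : L \subset S ->
  \sum_(j in S) emb t 0 j = \sum_k (tnth t k : R).
Proof.
move=> LS; rewrite -sum_emb [RHS](bigID (mem S))/= [X in _ + X]big1 ?addr0// => j jS.
by rewrite emb_notin//; apply: contra jS; exact: (fintype.subsetP LS).
Qed.

Lemma sum_emb_out L S (t : RT R #|L|) : [disjoint L & S]%B ->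
  \sum_(j in S) emb t 0 j = 0.
Proof. by move=> dLS; rewrite big1// => j jS; rewrite emb_notin// (disjointFl dLS). Qed.

Lemma extremal_std_simplex L (t : RT R #|L|) : (L \subset I) || (L \subset F) ->
  extremal (emb t) <-> std_simplex (emb t).
Proof.
move=> LIF.
have sumLe S (v : 'rV[R]_n) : (forall j, 0 <= v 0 j) -> \sum_(j in S) v 0 j <= \sum_j v 0 j.
  by move=> v0; rewrite [leRHS](bigID (mem S))/= lerDl sumr_ge0.
split => [[t0 tI tF]|[t0 t1]]; last by split => //; apply: le_trans t1; exact: sumLe.
by split => //; case/orP: LIF => /sum_emb_in H; rewrite sum_emb -H.
Qed.

Lemma vol_extremal L : (L \subset I) || (L \subset F) -> vol L extremal = ((#|L|)`!%:R)^-1.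
Proof.
move=> LIF; rewrite /vol (_ : mkset _ = [set t : RT R #|L| | std_simplex (emb t)]).
  by rewrite leb_std_simplex.
by apply/seteqP; split => t /=; rewrite -/(emb t) extremal_std_simplex.
Qed.

(** With r = 1 - |x|, the fibre is a product of simplices of size r in R^Y and R^Z, of volume
    r^(a+b) / (a! b!), while that of the standard simplex has volume r^(a+b) / (a+b)!. The ratio
    does not depend on x. *)
Lemma fiber_extremal (x : RT R #|J|) :
  fiber (~: J)%SET extremal (emb x) =
  (((#|Y| + #|Z|)`!%:R / ((#|Y|)`!%:R * (#|Z|)`!%:R))%:E *
     fiber (~: J)%SET std_simplex (emb x))%E.
Proof.
have dJ : [disjoint J & (~: J)%SET]%B by rewrite -setI_eq0 finset.setICr.
have dYZ : [disjoint Y & Z]%B by rewrite finset.disjoints_subset finset.setCK finset.subsetDl.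
have UYZ : (Y :|: Z)%SET = (~: J)%SET.
  by apply/setP => j; rewrite !inE; case: (boolP (j \in J)) => [/(fintype.subsetP JI) ->|_] //=; case: (j \in I).
have cYZ : #|(~: J)%SET| = (#|Y| + #|Z|)%N by rewrite -UYZ cardsU disjoint_setI0// cards0 subn0.
have dYF : [disjoint Y & F]%B.
  by rewrite -setI_eq0; apply/eqP/setP => j; rewrite !inE; case: (j \in I); case: (j \in J).
have dZI : [disjoint Z & I]%B by rewrite disjoint_sym finset.disjoints_subset finset.setCK.
have YI : Y \subset I by exact: finset.subsetDl.
have ZF : Z \subset F by exact: finset.subsetUr.
have JF : J \subset F by exact: finset.subsetUl.
have dYJ : [disjoint Y & J]%B.
  by rewrite -setI_eq0; apply/eqP/setP => j; rewrite !inE; case: (j \in J); rewrite ?andbF.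
have dZJ : [disjoint Z & J]%B.
  rewrite -setI_eq0; apply/eqP/setP => j; rewrite !inE; apply/negP => /andP[jI jJ].
  by rewrite (fintype.subsetP JI) in jI.
have [x0|x0] := pselect (forall k, 0 <= (tnth x k : R)); last first.
  rewrite fiber_std_simplex_neg// mule0 /fiber (_ : mkset _ = set0) ?measure0// -subset0 => y [H _ _].
  by have [_ x0'] := emb_add_ge0 dJ H; case: (x0 x0').
rewrite fiber_std_simplex// cYZ.
pose X := [set v | extremal (v + emb x)].
have bX : borel X.
  apply: (borel_preimage _ (closed_borel closed_extremal)) => k.
  rewrite (_ : (fun t => _) = (fun t : RT R n => (tnth t k : R) + emb x 0 k)); last first.
    by apply/funext => t; rewrite !mxE.
  by apply: measurable_funD => //; exact: measurable_tnth.
transitivity (leb (simplex #|Y| (1 - \sum_k (tnth x k : R))) * leb (simplex #|Z| (1 - \sum_k (tnth x k : R))))%E.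
  rewrite /fiber leb_sigma_app (leb_split dYZ UYZ bX).
  rewrite -!leb_sigma_app -product_measure1E//; try exact: measurable_simplex.
  congr product_measure1; apply/seteqP; split => -[y z].
    move=> [H HI HF]; split; split.
    - move=> k; have := H (enum_val k); rewrite !mxE emb_enum_val.
      rewrite (@emb_notin _ _ Z) ?(disjointFr dYZ) ?enum_valP//.
      by rewrite (@emb_notin _ _ J) ?(disjointFr dYJ) ?enum_valP// !addr0.
    - move: HI; under eq_bigr do rewrite !mxE; rewrite !big_split/=.
      by rewrite (sum_emb_in _ YI) (sum_emb_out _ dZI) (sum_emb_in _ JI) addr0 lerBrDr.
    - move=> k; have := H (enum_val k); rewrite !mxE emb_enum_val.
      rewrite (@emb_notin _ _ Y) ?(disjointFl dYZ) ?enum_valP//.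
      by rewrite (@emb_notin _ _ J) ?(disjointFr dZJ) ?enum_valP// addr0 add0r.
    - move: HF; under eq_bigr do rewrite !mxE; rewrite !big_split/=.
      by rewrite (sum_emb_in _ ZF) (sum_emb_out _ dYF) (sum_emb_in _ JF) add0r lerBrDr.
  move=> [[/emb_ge0 y0 y1] [/emb_ge0 z0 z1]]; have /emb_ge0 x0' := x0.
  split.
  - by move=> j; rewrite !mxE/=; apply: addr_ge0; [apply: addr_ge0; [exact: y0|exact: z0]|exact: x0'].
  - under eq_bigr do rewrite !mxE; rewrite !big_split/=.
    by rewrite (sum_emb_in _ YI) (sum_emb_out _ dZI) (sum_emb_in _ JI) addr0 -lerBrDr.
  - under eq_bigr do rewrite !mxE; rewrite !big_split/=.
    by rewrite (sum_emb_in _ ZF) (sum_emb_out _ dYF) (sum_emb_in _ JF) add0r -lerBrDr.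
have [r0|r0] := leP 0 (1 - \sum_k (tnth x k : R)); last first.
  by rewrite !simplex_neg// -!leb_sigma_app !measure0 !mule0.
rewrite !leb_simplex// -!EFinM exprD; congr EFin.
have f0 m : (m`!%:R : R) != 0 by rewrite pnatr_eq0 -lt0n fact_gt0.
by field; rewrite !f0.
Qed.

(** The constant ratio of fibre volumes integrates to the ratio of the volumes, and the simplex has
    volume 1 / n!. *)
Lemma vol_extremal_setT : vol [set: 'I_n]%SET extremal =
  (#|Y| + #|Z|)`!%:R / ((#|Y|)`!%:R * (#|Z|)`!%:R * n`!%:R).
Proof.
have dJ : [disjoint J & (~: J)%SET]%B by rewrite -setI_eq0 finset.setICr.
have fiberE (X : set 'rV[R]_n) : borel X ->
    leb [set t : RT R #|[set: 'I_n]%SET| | X (emb t)] =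
    (\int[leb_sigma #|J|]_x fiber (~: J)%SET X (emb x))%E.
  move=> bX; rewrite (leb_split dJ (finset.setUCr J) bX) product_measure1_section.
  apply: eq_integral => x _; congr (leb_sigma _ _).
  by apply/seteqP; split => y /=; rewrite addrC.
rewrite /vol (fiberE _ (closed_borel closed_extremal)).
under eq_integral do rewrite fiber_extremal.
have mf : measurable_fun setT (fun x : RT R #|J| => fiber (~: J)%SET std_simplex (emb x)).
  apply: measurable_fiber; first exact: borel_std_simplex.
  by move=> k; exact: measurable_emb.
rewrite ge0_integralZl_EFin//.
rewrite -(fiberE _ borel_std_simplex) leb_std_simplex cardsT card_ord -EFinM/=.
by rewrite [in RHS]invfM mulrA.
Qed.

End extremal_bodies.

(** * Boxes with long and thin sides, and passage to the limit *)

Section sharpness.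
Context {R : realType} {n : nat}.
Implicit Types (I J L : {set 'I_n}).

Lemma le_of_le_add_small (p q d : R) :
  (forall x, 0 < x <= 1 -> p <= q + x * d) -> p <= q.
Proof.
move=> H; apply/ler_addgt0Pr => e e0.
have d1 : 0 < `|d| + 1 by rewrite ltr_pwDr.
(* [|d| + 1] in the denominator because d may be 0 or negative. *)
pose x := Num.min 1 (e / (`|d| + 1)).
have x0 : 0 < x by rewrite lt_min ltr01 divr_gt0.
have x1 : x <= 1 by rewrite ge_min lexx.
apply: le_trans (H x _) _; first by rewrite x0.
rewrite lerD2l (le_trans (ler_norm _))// normrM gtr0_norm//.
apply: (@le_trans _ _ (e / (`|d| + 1) * `|d|)).
  by rewrite ler_wpM2r// ge_min lexx orbT.
by rewrite mulrAC ler_pdivrMr// ler_pM2l// lerDl.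
Qed.

(* As x tends to 0, every face volume of this box is negligible compared to the
   one indexed by G. *)
Definition spike_sides (G : {set 'I_n}) (x : R) (j : 'I_n) : R :=
  if j \in G then x^-1 else x.

Lemma spike_sides_gt0 G x j : 0 < x -> 0 < spike_sides G x j.
Proof. by move=> x0; rewrite /spike_sides; case: ifP; rewrite ?invr_gt0. Qed.

(** Compared with the face G, each index in the symmetric difference of L and G costs a factor x: a
    missing long side or an additional thin one. *)
Lemma vol_spike G L x : 0 < x ->
  vol L (box (spike_sides G x)) =
  x^-1 ^+ #|G| * \prod_j (if (j \in L) == (j \in G) then 1 else x).
Proof.
move=> x0; rewrite vol_box; last by move=> j; exact/ltW/spike_sides_gt0.
rewrite -prodr_const [in LHS]big_mkcond [X in X * _]big_mkcond/= -big_split/=.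
apply: eq_bigr => j _; rewrite /spike_sides.
by case: (j \in L); case: (j \in G); rewrite /= ?mulr1 ?mul1r// mulVf// gt_eqF.
Qed.

Lemma vol_spike_le G L x : 0 < x <= 1 -> L != G ->
  vol L (box (spike_sides G x)) <= x^-1 ^+ #|G| * x.
Proof.
move=> /andP[x0 x1] LG; rewrite vol_spike//.
rewrite ler_wpM2l ?exprn_ge0 ?invr_ge0 ?(ltW x0)//.
have [j jLG] : exists j, (j \in L) != (j \in G).
  apply/existsP; apply: contraR LG => /existsPn H; apply/eqP/setP => j.
  by apply/eqP; have := H j; rewrite negbK.
rewrite (bigD1 j)//= (negbTE jLG) ger_pMr//.
apply: prodr_ile1 => k _; by case: ifP; rewrite ?ler01 ?lexx ?(ltW x0)// x1.
Qed.

Lemma vol_spike_self G x : 0 < x -> vol G (box (spike_sides G x)) = x^-1 ^+ #|G|.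
Proof.
by move=> x0; rewrite vol_spike// big1 ?mulr1// => j _; rewrite eqxx.
Qed.

(** For the extremal A and the spike box B, division by the volume of the face G of B and x -> 0
    turn the assumed bound into |A| |P_J A| / |P_I A| <= c |P_F A|, which is an equality for c =
    d. *)
Theorem volume_ratio_sharp I c :
  (forall A B : set 'rV[R]_n, anti_blocking A -> anti_blocking B ->
     A° !=set0 -> B° !=set0 ->
     vol [set: 'I_n]%SET A / vol I (coord_proj I @` A)
       + vol [set: 'I_n]%SET B / vol I (coord_proj I @` B)
     <= c * (vol [set: 'I_n]%SET (mdiff A B)
               / vol I (coord_proj I @` mdiff A B))) ->
  rconst R n #|I| <= c.
Proof.
move=> Hc.
have In : (#|I| <= n)%N by rewrite -[X in (_ <= X)%N]card_ord max_card.
have fact0 m : (0 : R) < m`!%:R by rewrite ltr0n fact_gt0.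
suff key J : J \subset I -> dconst R n #|I| (#|J| + (n - #|I|)) <= c.
  rewrite /rconst; apply: bigmax_le.
    by apply: le_trans (key _ (finset.sub0set I)); rewrite /dconst divr_ge0.
  move=> [j jn] /= nij.
  pose N := (#|I| + j - n)%N.
  have NI : (N <= size (enum I))%N by rewrite -cardE /N; lia.
  pose J := [set k in take N (enum I)]%SET.
  have cJ : #|J| = N.
    by rewrite cardsE (card_uniqP _) ?take_uniq ?enum_uniq// size_takel.
  have JI : J \subset I.
    by apply/fintype.subsetP => k; rewrite inE => /mem_take; rewrite mem_enum.
  have arith m : (n <= m + j)%N -> (m <= n)%N -> (m + j - n + (n - m) = j)%N by lia.
  by have := key J JI; rewrite cJ /N (arith #|I|).
(* G is the complement of J in I and of F in the whole index set, so its face of B is paired with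
   P_J A in P_E (A - B) and with P_F A in A - B. *)
move=> JI; pose G := (I :\: J)%SET; pose F := (J :|: ~: I)%SET.
pose A : set 'rV[R]_n := extremal I J.
have cA : corner_body 1 A := corner_body_extremal I J.
have aA : anti_blocking A := anti_blocking_intro cA (@closed_extremal R n I J).
have vA L : (L \subset I) || (L \subset F) -> vol L A = ((#|L|)`!%:R)^-1.
  exact: vol_extremal.
have vJ : vol J A = ((#|J|)`!%:R)^-1 by rewrite vA// JI.
have vI : vol I A = ((#|I|)`!%:R)^-1 by rewrite vA// subxx.
have vF : vol F A = ((#|F|)`!%:R)^-1 by rewrite vA// subxx orbT.
have A0 L : 0 <= vol L A := vol_ge0 cA L.
have iA : A° !=set0.
  apply: (@box_interior _ _ _ (n.+1%:R^-1)); first by rewrite invr_gt0.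
  have sumle (S : {set 'I_n}) (v : 'rV[R]_n) : box (fun=> n.+1%:R^-1) v ->
      \sum_(j in S) v 0 j <= 1.
    move=> Hv; apply: (@le_trans _ _ (\sum_(j in S) n.+1%:R^-1)).
      by apply: ler_sum => j _; have /andP[] := Hv j.
    rewrite sumr_const -[leLHS]mulr_natl ler_pdivrMr// mul1r ler_nat.
    by rewrite (leq_trans (max_card _))// card_ord.
  by move=> v Hv; split; [move=> j; have /andP[] := Hv j|exact: sumle|exact: sumle].
pose vT := vol [set: 'I_n]%SET A.
pose Q := \sum_(L : {set 'I_n} | L \subset [set: 'I_n]%SET) vol L A.
(* The term x * (c * Q) absorbs the error: relative to the face G, every L other than F contributes
   at most x |P_L A|. *)
have ineq x : 0 < x <= 1 -> vT / vol I A * vol J A <= c * vol F A + x * (c * Q).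
  move=> /andP[x0 x1]; pose B := box (spike_sides G x).
  have x1' : 1 <= x^-1 by rewrite invf_ge1.
  have s0 j : 0 < spike_sides G x j by exact: spike_sides_gt0.
  have cB : corner_body x^-1 B.
    apply: corner_body_box => j; rewrite ltW//= /spike_sides.
    by case: ifP => // _; apply: le_trans x1'.
  have aB : anti_blocking B by apply: (anti_blocking_intro cB); exact: closed_box.
  have B0 L : 0 <= vol L B := vol_ge0 cB L.
  have iB : B° !=set0.
    apply: (@box_interior _ _ _ x) => // v Hv j; have /andP[-> vx] := Hv j.
    by rewrite (le_trans vx)// /spike_sides; case: ifP => // _; apply: le_trans x1'.
  have := Hc A B aA aB iA iB.
  rewrite (vol_coord_proj_mdiff _ cA cB) !vol_coord_proj; last 2 first.
  - by move=> v; exact: corner_coord_proj cB.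
  - by move=> v; exact: corner_coord_proj cA.
  rewrite !(vol_mdiff cA cB).
  set V := \sum_(L : {set 'I_n} | L \subset [set: 'I_n]%SET) _.
  set S := \sum_(L : {set 'I_n} | L \subset I) _ => H.
  pose Tm := x^-1 ^+ #|G|; have Tm0 : 0 < Tm by rewrite exprn_gt0// invr_gt0.
  have SJ : vol J A * Tm <= S.
    rewrite /S (bigD1 J)//= vol_spike_self// lerDl sumr_ge0// => L _.
    by rewrite mulr_ge0.
  have VF : V <= Tm * (vol F A + x * Q).
    rewrite /V /Q mulr_sumr (bigD1 F) ?finset.subsetT//=.
    rewrite [X in _ <= Tm * (_ + X)](bigD1 F) ?finset.subsetT//= addrA mulrDr lerD//.
      have -> : ([set: 'I_n] :\: F)%SET = G.
        by apply/setP => j; rewrite !inE negb_or negbK andbT.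
      rewrite vol_spike_self// mulrC ler_wpM2l ?(ltW Tm0)// lerDl mulr_ge0//.
      exact: ltW.
    rewrite mulr_sumr ler_sum// => L /andP[_ LF].
    have TLG : ([set: 'I_n] :\: L)%SET != G.
      apply: contra LF => /eqP TLG; apply/eqP/setP => j.
      have /setP/(_ j) := TLG; rewrite !inE.
      by case: (j \in L); case: (j \in J); case: (j \in I).
    rewrite (_ : Tm * (x * vol L A) = vol L A * (Tm * x)); last by ring.
    by rewrite ler_wpM2l// vol_spike_le// x0.
  have vT0 : 0 < vT.
    rewrite /vT /A vol_extremal_setT//; by rewrite divr_gt0 ?mulr_gt0.
  have S0 : 0 < S by apply: lt_le_trans SJ; rewrite mulr_gt0// vJ invr_gt0.
  have vI0 : 0 < vol I A by rewrite vI invr_gt0.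
  (* The quotient of B is nonnegative and is dropped. *)
  have step : vT / vol I A * S <= c * V.
    rewrite -ler_pdivlMr// -mulrA; apply: le_trans H; rewrite lerDl.
    by rewrite divr_ge0.
  have V0 : 0 <= V by rewrite /V sumr_ge0// => L _; rewrite mulr_ge0.
  have cV0 : 0 < c * V by apply: lt_le_trans step; rewrite mulr_gt0// divr_gt0.
  (* The sign of c is forced: c V has a positive lower bound and V is nonnegative. It is needed to
     multiply the upper bound of V by c. *)
  have c0 : 0 <= c.
    rewrite leNgt; apply/negP => c_lt0; move: cV0; rewrite ltNge => /negP; apply.
    by rewrite mulr_le0_ge0// ltW.
  have lhs : vT / vol I A * (vol J A * Tm) <= vT / vol I A * S.
    by apply: ler_wpM2l => //; rewrite divr_ge0// ltW.
  rewrite -(ler_pM2r Tm0) -[leLHS]mulrA.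
  apply: le_trans lhs _; apply: le_trans step _; apply: le_trans (ler_wpM2l c0 VF) _.
  by rewrite le_eqVlt; apply/orP; left; apply/eqP; ring.
have := le_of_le_add_small ineq.
rewrite /vT /A vol_extremal_setT// vI vJ vF.
have Nn : (#|J| <= #|I|)%N by exact: subset_leq_card.
have cG : #|I :\: J|%SET = (#|I| - #|J|)%N by rewrite cardsDS.
have cZ : #|~: I|%SET = (n - #|I|)%N by rewrite cardsCs finset.setCK card_ord.
have cF : #|F| = (#|J| + (n - #|I|))%N.
  rewrite /F cardsU cZ disjoint_setI0 ?cards0 ?subn0//.
  by rewrite finset.disjoints_subset finset.setCK.
rewrite cG cZ cF /dconst.
rewrite (_ : (#|I| + (#|J| + (n - #|I|)) - n = #|J|)%N); last by lia.
have f0 m : (m`!%:R : R) != 0 by rewrite gt_eqF.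
have jN : (#|J| + (n - #|I|) - #|J| = n - #|I|)%N by lia.
have nN : (#|I| - #|J| + (n - #|I|) = n - #|J|)%N by lia.
rewrite nN -ler_pdivrMr ?invr_gt0// invrK => H; apply: le_trans H.
(* What remains is that |A| |P_J A| / (|P_I A| |P_F A|) equals d; the factorials are rewritten
   through binomials. *)
rewrite -(bin_fact Nn) -(bin_fact (leq_addr (n - #|I|) #|J|)) -(bin_fact (leq_trans Nn In)) jN.
have b3 : ('C(#|J| + (n - #|I|), #|J|)%:R : R) != 0 by rewrite pnatr_eq0 -lt0n bin_gt0 leq_addr.
have b2 : ('C(n, #|J|)%:R : R) != 0 by rewrite pnatr_eq0 -lt0n bin_gt0 (leq_trans Nn).
rewrite !natrM le_eqVlt; apply/orP; left; apply/eqP.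
by field; rewrite b2 b3 !f0.
Qed.

End sharpness.

(** Optimality is tested on bodies with nonempty interior only. All volumes in the quotients are
    then positive, so the best constant is not an effect of the convention for division by 0. *)
Theorem theorem12 (R : realType) (n i : nat) (I : {set 'I_n})
    (I_proper : I \proper [set: 'I_n]%SET) (cardI : #|I| = i) :
  (forall A B : set 'rV[R]_n, anti_blocking A -> anti_blocking B ->
     vol [set: 'I_n]%SET A / vol I (coord_proj I @` A)
       + vol [set: 'I_n]%SET B / vol I (coord_proj I @` B)
     <= rconst R n i * (vol [set: 'I_n]%SET (mdiff A B)
                     / vol I (coord_proj I @` mdiff A B)))
  /\
  (forall c : R,
     (forall A B : set 'rV[R]_n, anti_blocking A -> anti_blocking B ->
        A° !=set0 -> B° !=set0 ->
        vol [set: 'I_n]%SET A / vol I (coord_proj I @` A)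
          + vol [set: 'I_n]%SET B / vol I (coord_proj I @` B)
        <= c * (vol [set: 'I_n]%SET (mdiff A B)
                  / vol I (coord_proj I @` mdiff A B))) ->
     rconst R n i <= c).
Proof.
rewrite -cardI; split; first by move=> A B; exact: volume_ratio_upper_bound.
exact: volume_ratio_sharp.
Qed.
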